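(* The set of (Gödel numbers of) constructively true arithmetical sentences is both $\Pi^1_2$-hard and $\Sigma^1_2$-hard: every $\Pi^1_2$ set and every $\Sigma^1_2$ set of natural numbers is many-one reducible, by a recursive function, to the set of constructively true arithmetical sentences.
   Context: Arithmetical formulas are first-order formulas in $0,1,+,\cdot,<,=$, $\neg,\wedge,\vee,\rightarrow$, $\exists,\forall$ over the natural numbers. Witnesses (continuous function realizability, essentially Kleene's function realizability) are sets of natural numbers defined by recursion on formulas with free variables assigned natural numbers: a witness for an atomic formula or for $\neg A$ exists iff the formula is true ($\neg A$ is true iff $A$ has no witness) and carries no information; for $A\wedge B$, witnesses for both; for $A\vee B$, a choice of disjunct plus a witness for it; for $\exists x\,A(x)$, a number $n$ and a witness for $A(n)$; for $\forall x\,A(x)$, on input $n$ a witness for $A(n)$; for $A\rightarrow B$, a real $W$ coding a continuous map (output determined by finite initial segments of input) such that for every witness $X$ of $A$ (arbitrary, not necessarily computable), $W_X$ is a witness for $B$. A sentence is constructively true iff it has a recursive witness. *)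

(* Defs.v *)
From Stdlib Require Import Arith.
From Stdlib Require Vector Fin Cantor.

Set Implicit Arguments.
Unset Strict Implicit.
Unset Printing Implicit Defensive.

Notation vec := (Vector.t nat).

(** General recursive functions: the least class of total functions containing
    the initial functions and closed under composition, primitive recursion and
    minimization of regular functions. *)
Inductive recursive : forall k, (vec k -> nat) -> Prop :=
| rec_zero k : recursive (fun _ : vec k => 0)
| rec_succ : recursive (fun v : vec 1 => S (Vector.hd v))
| rec_proj k (i : Fin.t k) : recursive (fun v : vec k => Vector.nth v i)
| rec_comp k m (f : vec m -> nat) (g : Vector.t (vec k -> nat) m) :
    recursive f -> (forall i : Fin.t m, recursive (Vector.nth g i)) ->
    recursive (fun v : vec k => f (Vector.map (fun gi => gi v) g))
| rec_prim k (f : vec k -> nat) (g : vec (S (S k)) -> nat) :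
    recursive f -> recursive g ->
    recursive (fun v : vec (S k) =>
      nat_rect (fun _ => nat)
        (f (Vector.tl v))
        (fun n r => g (Vector.cons nat n _ (Vector.cons nat r _ (Vector.tl v))))
        (Vector.hd v))
| rec_mu k (f : vec (S k) -> nat) (g : vec k -> nat) :
    recursive f ->
    (forall v, f (Vector.cons nat (g v) _ v) = 0 /\
               forall m, m < g v -> f (Vector.cons nat m _ v) <> 0) ->
    recursive g.

Definition recursive1 (f : nat -> nat) : Prop :=
  recursive (fun v : vec 1 => f (Vector.hd v)).

Definition many_one_reducible (S T : nat -> Prop) : Prop :=
  exists f, recursive1 f /\ forall n, S n <-> T (f n).

(** Sets of natural numbers over which second-order quantifiers and witnesses
    range, given by their characteristic functions.  With excluded middle and
    choice every predicate [nat -> Prop] has one. *)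
Definition real := nat -> bool.

Definition recursive_real (X : real) : Prop :=
  recursive1 (fun n => Nat.b2n (X n)).

(** Variables are de Bruijn indices. *)
Inductive term :=
| Var (i : nat)
| Zero
| One
| Add (s t : term)
| Mul (s t : term).

(** Formulas of arithmetic with set parameters indexed by [V].  All quantifiers
    are number quantifiers; [V := Empty_set] gives the pure arithmetical
    formulas. *)
Inductive formula (V : Type) :=
| Eq (s t : term)
| Lt (s t : term)
| Mem (t : term) (P : V)
| Not (A : formula V)
| And (A B : formula V)
| Or (A B : formula V)
| Imp (A B : formula V)
| Ex (A : formula V)
| All (A : formula V).

Arguments Eq {V} s t.
Arguments Lt {V} s t.

Definition arith_formula := formula Empty_set.

Fixpoint term_bounded (k : nat) (t : term) : Prop :=
  match t with
  | Var i => i < k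
  | Zero | One => True
  | Add s t | Mul s t => term_bounded k s /\ term_bounded k t
  end.

(** All free number variables have index below [k]. *)
Fixpoint bounded V (k : nat) (A : formula V) : Prop :=
  match A with
  | Eq s t | Lt s t => term_bounded k s /\ term_bounded k t
  | Mem t _ => term_bounded k t
  | Not A => bounded k A
  | And A B | Or A B | Imp A B => bounded k A /\ bounded k B
  | Ex A | All A => bounded (S k) A
  end.

Definition sentence (A : arith_formula) : Prop := bounded 0 A.

Definition env := nat -> nat.

Definition scons (n : nat) (e : env) : env :=
  fun i => match i with 0 => n | S j => e j end.

Fixpoint eval (e : env) (t : term) : nat :=
  match t with
  | Var i => e i
  | Zero => 0
  | One => 1
  | Add s t => eval e s + eval e t
  | Mul s t => eval e s * eval e t
  end.

(** Classical truth. *)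
Fixpoint sat V (P : V -> real) (e : env) (A : formula V) : Prop :=
  match A with
  | Eq s t => eval e s = eval e t
  | Lt s t => eval e s < eval e t
  | Mem t X => P X (eval e t) = true
  | Not A => ~ sat P e A
  | And A B => sat P e A /\ sat P e B
  | Or A B => sat P e A \/ sat P e B
  | Imp A B => sat P e A -> sat P e B
  | Ex A => exists n, sat P (scons n e) A
  | All A => forall n, sat P (scons n e) A
  end.

(** The lightface classes of the analytical hierarchy.  The matrix has the two
    set parameters [X] (index [false]) and [Y] (index [true]) and the single
    free number variable 0. *)
Definition matrix (phi : formula bool) (n : nat) (X Y : real) : Prop :=
  sat (fun b : bool => if b then Y else X) (scons n (fun _ => 0)) phi.

Definition Sigma12 (S : nat -> Prop) : Prop :=
  exists phi : formula bool, bounded 1 phi /\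
    forall n, S n <-> exists X, forall Y, matrix phi n X Y.

Definition Pi12 (S : nat -> Prop) : Prop :=
  exists phi : formula bool, bounded 1 phi /\
    forall n, S n <-> forall X, exists Y, matrix phi n X Y.

Definition even_part (X : real) : real := fun i => X (2 * i).
Definition odd_part (X : real) : real := fun i => X (2 * i + 1).
Definition row (X : real) (n : nat) : real := fun i => X (Cantor.to_nat (n, i)).
Definition shift (k : nat) (X : real) : real := fun i => X (k + i).

(** [X] is the sequence of [n] ones followed by a zero and then by [Y], where
    [Y = shift (S n) X]. *)
Definition starts_with (X : real) (n : nat) : Prop :=
  (forall i, i < n -> X i = true) /\ X n = false.

(** Code of the initial segment of [X] of length [k]: its bits in binary behind
    a leading 1, so that both [k] and the bits can be recovered. *)
Fixpoint segment (X : real) (k : nat) : nat :=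
  match k with
  | 0 => 1
  | S j => 2 * segment X j + Nat.b2n (X j)
  end.

(** [W] codes a partial continuous map on reals.  Asked for bit [n] of the
    output, it reads ever longer initial segments of [X]; [even_part W] tells
    whether the segment suffices for an answer, and at the first segment that
    does, [odd_part W] gives the answer.  The map is defined at [X], with value
    [Y], when every bit gets answered.  The map need not be total (a total
    continuous map on Cantor space is uniformly continuous). *)
Definition maps_to (W X Y : real) : Prop :=
  forall n, exists k,
    (forall j, j < k -> even_part W (Cantor.to_nat (n, segment X j)) = false) /\
    even_part W (Cantor.to_nat (n, segment X k)) = true /\
    odd_part W (Cantor.to_nat (n, segment X k)) = Y n.

(** [witness e A X]: the real [X] is a witness for [A] under the assignment [e].
    For true atomic formulas and true negations, every real is a witness. *)
Fixpoint witness (e : env) (A : arith_formula) (X : real) {struct A} : Prop :=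
  match A with
  | Eq s t => eval e s = eval e t
  | Lt s t => eval e s < eval e t
  | Mem _ P => match P with end
  | Not A => ~ exists Y, witness e A Y
  | And A B => witness e A (even_part X) /\ witness e B (odd_part X)
  | Or A B => if X 0 then witness e B (shift 1 X) else witness e A (shift 1 X)
  | Imp A B => forall Y, witness e A Y -> exists Z, maps_to X Y Z /\ witness e B Z
  | Ex A => exists n, starts_with X n /\ witness (scons n e) A (shift (S n) X)
  | All A => forall n, witness (scons n e) A (row X n)
  end.

(** The choice of assignment is immaterial for sentences. *)
Definition constructively_true (A : arith_formula) : Prop :=
  exists W, recursive_real W /\ witness (fun _ => 0) A W.

Definition tag (c n : nat) : nat := Cantor.to_nat (c, n).
Definition tag2 (c m n : nat) : nat := tag c (Cantor.to_nat (m, n)).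

Fixpoint term_code (t : term) : nat :=
  match t with
  | Var i => tag 0 i
  | Zero => tag 1 0
  | One => tag 2 0
  | Add s t => tag2 3 (term_code s) (term_code t)
  | Mul s t => tag2 4 (term_code s) (term_code t)
  end.

Fixpoint godel (A : arith_formula) : nat :=
  match A with
  | Eq s t => tag2 0 (term_code s) (term_code t)
  | Lt s t => tag2 1 (term_code s) (term_code t)
  | Mem _ P => match P with end
  | Not A => tag 2 (godel A)
  | And A B => tag2 3 (godel A) (godel B)
  | Or A B => tag2 4 (godel A) (godel B)
  | Imp A B => tag2 5 (godel A) (godel B)
  | Ex A => tag 6 (godel A)
  | All A => tag 7 (godel A)
  end.

Definition constructive_truth (m : nat) : Prop :=
  exists A, sentence A /\ constructively_true A /\ m = godel A.

(* Main.v *)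
(** Fix a [Pi12] set, in the form [forall x exists y forall k, ~ K n (x|k) (y|k)]
    with [K] arithmetical.  For each [m] consider, as a formula, the following
    task: given a function [x] and a functional that finds, for every [y], finite
    pieces of [x] and [y] in [K], produce a claim.  Arithmetical predicates
    depending on [m] decide which atoms "[x] has value [w] at [i]" and "[y] has
    value [w] at [i]" are valid; [x], [y] and the pieces must consist of valid
    atoms, and claims assert validity of further atoms of [y] or of conflicting
    atoms of [x].

    If [forall x exists y forall k, ~ K], a functional as above has to lie about [x]
    or [y], and any lie, found by a search through finite parts of [y]'s, is a
    correct claim, since at most one atom is invalid.  If the [Pi12] statement
    fails, honest functionals exist, and every realizer [F] of the task makes some
    claim after inspecting finitely much of an honest-looking input.  Validity is
    defined by diagonalization: if the [m]-th recursive function, at [m], returns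
    such a finite input and claim, then that claim is made wrong for [m], while the
    inspected positions are exempted from coding, so that the finite input extends
    to an honest one whatever the true [x] is.  Hence the map sending [m] to the
    input and claim found from [F] differs from every recursive function.  So the
    task has a recursive realizer iff the [Pi12] statement holds, and "task implies
    an arithmetical statement without recursive witness" has one iff it fails. *)

From Stdlib Require Import Arith Lia List Bool Classical ClassicalEpsilon FunctionalExtensionality.
From Stdlib Require Vector Fin Cantor.
Require Import Defs.

Set Implicit Arguments.
Unset Strict Implicit.
Unset Printing Implicit Defensive.

(** * Recursive functions *)

(** The counterexample [g] to a failing instance may be far from computable, while records must be
    found from [F] alone. The search therefore runs through all finite tables, and every table with
    valid values of [x] must begin some honest input. Only positions from [bound m] on carry [g].
    The answers which a table prescribes for early codes [u] of sequences of [y] are fixed before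
    anything is known about their merit. The void clause makes them good: a nonempty [u] below
    [bound m] has its first entry below [bound m], at a position below [bound m]. When a lie is
    sought, that clause is harmless, since [y] can be given the value [bound m] at all early
    positions.

    The number [bound m] is not assumed computable. It is arithmetical, so formulas may mention it,
    whereas the recursive realizers never consult it.

    The converse directions share one argument: a recursive claimant and a recursive map from
    claimants to escapers would together give a recursive escaper. *)

Fixpoint venv k (v : vec k) : env :=
  match v with
  | Vector.nil _ => fun _ => 0
  | Vector.cons _ x _ w => scons x (venv w)
  end.

(** Environments default to 0 beyond the vector, so variables need no proof of being in range. *)
Definition rec_fn k (f : env -> nat) : Prop := recursive (fun v : vec k => f (venv v)).

Definition rec_pred k (p : env -> bool) : Prop := rec_fn k (fun e => Nat.b2n (p e)).

Lemma recursive_ext k (f g : vec k -> nat) :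
  (forall v, f v = g v) -> recursive f -> recursive g.
Proof. intros H. replace g with f; auto. now apply functional_extensionality. Qed.

Lemma rec_ext k f g : (forall e, f e = g e) -> rec_fn k f -> rec_fn k g.
Proof. intros H. apply recursive_ext. auto. Qed.

Lemma nth_venv k (v : vec k) (i : Fin.t k) :
  Vector.nth v i = venv v (proj1_sig (Fin.to_nat i)).
Proof.
  induction v as [|x k v IH]; [inversion i|].
  apply (Fin.caseS' i); [reflexivity|]. clear i.
  intros i. change (Vector.nth v i = venv (Vector.cons nat x k v) (proj1_sig (Fin.to_nat (Fin.FS i)))).
  rewrite IH. simpl. destruct (Fin.to_nat i). reflexivity.
Qed.

Lemma venv_default k (v : vec k) i : k <= i -> venv v i = 0.
Proof.
  revert i; induction v as [|x k v IH]; intros i Hi; [reflexivity|].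
  destruct i; [lia|]. simpl. apply IH; lia.
Qed.

Lemma rec_var k i : rec_fn k (fun e => e i).
Proof.
  destruct (lt_dec i k) as [H|H].
  - apply recursive_ext with (2 := rec_proj (Fin.of_nat_lt H)).
    intros v. rewrite nth_venv, Fin.to_nat_of_nat. reflexivity.
  - apply recursive_ext with (2 := rec_zero k).
    intros v. rewrite venv_default; lia.
Qed.

Lemma vector_tabulate k A (f : Fin.t k -> A) : exists v, forall i, Vector.nth v i = f i.
Proof.
  induction k as [|k IH].
  - exists (Vector.nil A). intros i; inversion i.
  - destruct (IH (fun i => f (Fin.FS i))) as [v Hv].
    exists (Vector.cons A (f Fin.F1) k v).
    intros i; apply (Fin.caseS' i); clear i; [reflexivity|]. exact Hv.
Qed.

Lemma rec_subst k m (f : env -> nat) (g : Vector.t (env -> nat) m) :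
  rec_fn m f -> (forall i, rec_fn k (Vector.nth g i)) ->
  rec_fn k (fun e => f (venv (Vector.map (fun h => h e) g))).
Proof.
  intros Hf Hg.
  pose proof (@rec_comp k m _ (Vector.map (fun h (v : vec k) => h (venv v)) g) Hf) as H.
  eapply recursive_ext; [|apply H].
  - intros v. simpl. rewrite Vector.map_map. reflexivity.
  - intros i. erewrite Vector.nth_map; [|reflexivity]. apply Hg.
Qed.

Lemma rec_app1 (F : nat -> nat) :
  rec_fn 1 (fun e => F (e 0)) ->
  forall k g, rec_fn k g -> rec_fn k (fun e => F (g e)).
Proof.
  intros HF k g Hg.
  apply (@rec_subst k 1 _ (Vector.cons _ g _ (Vector.nil _)) HF).
  intros i; apply (Fin.caseS' i); clear i; [exact Hg|intros i; inversion i].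
Qed.

Lemma rec_app2 (F : nat -> nat -> nat) :
  rec_fn 2 (fun e => F (e 0) (e 1)) ->
  forall k g h, rec_fn k g -> rec_fn k h -> rec_fn k (fun e => F (g e) (h e)).
Proof.
  intros HF k g h Hg Hh.
  apply (@rec_subst k 2 _ (Vector.cons _ g _ (Vector.cons _ h _ (Vector.nil _))) HF).
  intros i; apply (Fin.caseS' i); clear i; [exact Hg|].
  intros i; apply (Fin.caseS' i); clear i; [exact Hh|intros i; inversion i].
Qed.

Lemma rec_app3 (F : nat -> nat -> nat -> nat) :
  rec_fn 3 (fun e => F (e 0) (e 1) (e 2)) ->
  forall k g h l, rec_fn k g -> rec_fn k h -> rec_fn k l ->
  rec_fn k (fun e => F (g e) (h e) (l e)).
Proof.
  intros HF k g h l Hg Hh Hl.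
  apply (@rec_subst k 3 _
    (Vector.cons _ g _ (Vector.cons _ h _ (Vector.cons _ l _ (Vector.nil _)))) HF).
  intros i; apply (Fin.caseS' i); clear i; [exact Hg|].
  intros i; apply (Fin.caseS' i); clear i; [exact Hh|].
  intros i; apply (Fin.caseS' i); clear i; [exact Hl|intros i; inversion i].
Qed.

Lemma rec_app4 (F : nat -> nat -> nat -> nat -> nat) :
  rec_fn 4 (fun e => F (e 0) (e 1) (e 2) (e 3)) ->
  forall k g h l o, rec_fn k g -> rec_fn k h -> rec_fn k l -> rec_fn k o ->
  rec_fn k (fun e => F (g e) (h e) (l e) (o e)).
Proof.
  intros HF k g h l o Hg Hh Hl Ho.
  apply (@rec_subst k 4 _ (Vector.cons _ g _
    (Vector.cons _ h _ (Vector.cons _ l _ (Vector.cons _ o _ (Vector.nil _))))) HF).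
  intros i; apply (Fin.caseS' i); clear i; [exact Hg|].
  intros i; apply (Fin.caseS' i); clear i; [exact Hh|].
  intros i; apply (Fin.caseS' i); clear i; [exact Hl|].
  intros i; apply (Fin.caseS' i); clear i; [exact Ho|intros i; inversion i].
Qed.

Lemma rec_S k g : rec_fn k g -> rec_fn k (fun e => S (g e)).
Proof.
  apply (@rec_app1 S). eapply recursive_ext; [|exact rec_succ].
  intros v. apply (Vector.caseS' v). reflexivity.
Qed.

Lemma rec_const k n : rec_fn k (fun _ => n).
Proof. induction n; [apply (rec_zero k)|now apply rec_S]. Qed.

Lemma rec_nat_rect k f (g : nat -> nat -> env -> nat) h :
  rec_fn k f ->
  rec_fn (S (S k)) (fun e => g (e 0) (e 1) (fun i => e (S (S i)))) ->
  rec_fn k h ->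
  rec_fn k (fun e => nat_rect (fun _ => nat) (f e) (fun n r => g n r e) (h e)).
Proof.
  intros Hf Hg Hh. pose proof (rec_prim Hf Hg) as Hr.
  (* The vector [ps] of all projections passes the parameters on unchanged behind the recursion
     count [h]. *)
  destruct (vector_tabulate (fun i : Fin.t k => fun v : vec k => Vector.nth v i)) as [ps Hps].
  pose proof (@rec_comp k (S k) _ (Vector.cons _ (fun v => h (venv v)) _ ps) Hr) as H.
  eapply recursive_ext; [|apply H].
  - intros v. simpl.
    assert (E : Vector.map (fun gi => gi v) ps = v).
    { apply Vector.eq_nth_iff. intros i ? <-.
      erewrite Vector.nth_map; [|reflexivity]. now rewrite Hps. }
    rewrite E. reflexivity.
  - intros i; apply (Fin.caseS' i); clear i; [exact Hh|].
    intros i. simpl. rewrite Hps. apply rec_proj.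
Qed.

Lemma rec_min k (f : nat -> env -> nat) g :
  rec_fn (S k) (fun e => f (e 0) (fun i => e (S i))) ->
  (forall e, f (g e) e = 0 /\ forall m, m < g e -> f m e <> 0) ->
  rec_fn k g.
Proof.
  intros Hf H. apply (rec_mu Hf). intros v. apply (H (venv v)).
Qed.

Lemma recursive1_iff f : recursive1 f <-> rec_fn 1 (fun e => f (e 0)).
Proof.
  split; apply recursive_ext; intros v; apply (Vector.caseS' v); reflexivity.
Qed.

Create HintDb recdb.
#[global] Hint Resolve rec_var rec_const rec_S : recdb.

Ltac solve_rec := cbv beta in *; auto 60 with recdb.

Lemma rec_pred_nat k g : rec_fn k g -> rec_fn k (fun e => pred (g e)).
Proof.
  apply (@rec_app1 pred).
  apply rec_ext with (fun e => nat_rect (fun _ => nat) 0 (fun n _ => n) (e 0)).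
  - intros e. destruct (e 0); reflexivity.
  - apply (@rec_nat_rect 1 (fun _ => 0) (fun n _ _ => n)); solve_rec.
Qed.

Lemma rec_add k g h : rec_fn k g -> rec_fn k h -> rec_fn k (fun e => g e + h e).
Proof.
  apply (@rec_app2 Nat.add).
  apply rec_ext with (fun e => nat_rect (fun _ => nat) (e 1) (fun _ r => S r) (e 0)).
  - intros e. induction (e 0); simpl; auto.
  - apply (@rec_nat_rect 2 (fun e => e 1) (fun _ r _ => S r)); solve_rec.
Qed.
#[global] Hint Resolve rec_pred_nat rec_add : recdb.

Lemma rec_mul k g h : rec_fn k g -> rec_fn k h -> rec_fn k (fun e => g e * h e).
Proof.
  apply (@rec_app2 Nat.mul).
  apply rec_ext with (fun e => nat_rect (fun _ => nat) 0 (fun _ r => e 1 + r) (e 0)).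
  - intros e. induction (e 0); simpl; auto.
  - apply (@rec_nat_rect 2 (fun _ => 0) (fun _ r e => e 1 + r)); solve_rec.
Qed.

Lemma rec_sub k g h : rec_fn k g -> rec_fn k h -> rec_fn k (fun e => g e - h e).
Proof.
  apply (@rec_app2 Nat.sub).
  apply rec_ext with (fun e => nat_rect (fun _ => nat) (e 0) (fun _ r => pred r) (e 1)).
  - intros e. induction (e 1) as [|n IH]; [symmetry; apply Nat.sub_0_r|].
    etransitivity; [exact (f_equal pred IH)|lia].
  - apply (@rec_nat_rect 2 (fun e => e 0) (fun _ r _ => pred r)); solve_rec.
Qed.
#[global] Hint Resolve rec_mul rec_sub : recdb.

Lemma rec_if k (p : env -> bool) g h :
  rec_pred k p -> rec_fn k g -> rec_fn k h -> rec_fn k (fun e => if p e then g e else h e).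
Proof.
  intros Hp Hg Hh.
  apply rec_ext with (fun e => Nat.b2n (p e) * g e + (1 - Nat.b2n (p e)) * h e).
  - intros e. destruct (p e); simpl; lia.
  - unfold rec_pred in Hp. solve_rec.
Qed.

Lemma rec_pred_ext k p q : (forall e, p e = q e) -> rec_pred k p -> rec_pred k q.
Proof. intros H. apply rec_ext. intros e. now rewrite H. Qed.

Lemma rec_leb k g h : rec_fn k g -> rec_fn k h -> rec_pred k (fun e => g e <=? h e).
Proof.
  intros Hg Hh. apply rec_ext with (fun e => 1 - (g e - h e)); [|solve_rec].
  intros e. destruct (Nat.leb_spec (g e) (h e)); cbn [Nat.b2n]; lia.
Qed.

Lemma rec_ltb k g h : rec_fn k g -> rec_fn k h -> rec_pred k (fun e => g e <? h e).
Proof. intros Hg Hh. apply (@rec_leb k (fun e => S (g e)) h); solve_rec. Qed.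

Lemma rec_eqb k g h : rec_fn k g -> rec_fn k h -> rec_pred k (fun e => g e =? h e).
Proof.
  intros Hg Hh. apply rec_ext with (fun e => 1 - ((g e - h e) + (h e - g e))); [|solve_rec].
  intros e. destruct (Nat.eqb_spec (g e) (h e)); cbn [Nat.b2n]; lia.
Qed.

Lemma rec_andb k p q : rec_pred k p -> rec_pred k q -> rec_pred k (fun e => p e && q e).
Proof.
  unfold rec_pred. intros Hp Hq. apply rec_ext with (fun e => Nat.b2n (p e) * Nat.b2n (q e)).
  - intros e. destruct (p e), (q e); reflexivity.
  - solve_rec.
Qed.

Lemma rec_negb k p : rec_pred k p -> rec_pred k (fun e => negb (p e)).
Proof.
  unfold rec_pred. intros Hp. apply rec_ext with (fun e => 1 - Nat.b2n (p e)).
  - intros e. destruct (p e); reflexivity.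
  - solve_rec.
Qed.

Lemma rec_ifb k (p q r : env -> bool) :
  rec_pred k p -> rec_pred k q -> rec_pred k r -> rec_pred k (fun e => if p e then q e else r e).
Proof.
  unfold rec_pred at 2 3 4. intros Hp Hq Hr.
  apply rec_ext with (fun e => if p e then Nat.b2n (q e) else Nat.b2n (r e)).
  - intros e. destruct (p e); reflexivity.
  - now apply rec_if.
Qed.

Lemma rec_eqbool k p q : rec_pred k p -> rec_pred k q -> rec_pred k (fun e => Bool.eqb (p e) (q e)).
Proof.
  intros Hp Hq. apply rec_pred_ext with (fun e => if p e then q e else negb (q e)).
  - intros e. destruct (p e), (q e); reflexivity.
  - now apply rec_ifb, rec_negb.
Qed.

Lemma rec_b2n k p : rec_pred k p -> rec_fn k (fun e => Nat.b2n (p e)).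
Proof. auto. Qed.

#[global] Hint Resolve rec_if rec_leb rec_ltb rec_eqb rec_andb rec_negb rec_ifb rec_eqbool rec_b2n
  : recdb.

(** * Bounded minimization and search *)

Definition bmin (n : nat) (p : nat -> bool) : nat :=
  nat_rect (fun _ => nat) 0 (fun i r => if r <? i then r else if p i then i else S i) n.

Lemma bmin_spec n p :
  (forall i, i < bmin n p -> p i = false) /\
  (bmin n p = n \/ bmin n p < n /\ p (bmin n p) = true).
Proof.
  induction n as [|n [IH1 IH2]]; [simpl; split; [lia|now left]|].
  change (bmin (S n) p) with
    (if bmin n p <? n then bmin n p else if p n then n else S n).
  destruct (Nat.ltb_spec (bmin n p) n).
  - split; [exact IH1|]. right. destruct IH2 as [|[]]; [lia|]. split; auto.
  - assert (E : bmin n p = n) by lia. rewrite E in IH1.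
    destruct (p n) eqn:Hn.
    + split; [exact IH1|right; auto].
    + split; [|now left]. intros i Hi.
      destruct (Nat.eq_dec i n); [now subst|apply IH1; lia].
Qed.

Lemma bmin_lt n p i : i < n -> p i = true -> bmin n p < n /\ p (bmin n p) = true.
Proof.
  intros Hi Hp. destruct (bmin_spec n p) as [H [E|]]; auto.
  rewrite H in Hp; [discriminate|lia].
Qed.

(** The hypothesis on [r] sends positions that default to 0 to positions that default to 0. *)
Lemma rec_rename n m (f : env -> nat) (r : nat -> nat) :
  (forall i, n <= i -> m <= r i) -> rec_fn n f -> rec_fn m (fun e => f (fun i => e (r i))).
Proof.
  intros Hr Hf.
  destruct (vector_tabulate (fun i : Fin.t n => fun e : env => e (r (proj1_sig (Fin.to_nat i)))))
    as [g Hg].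
  eapply recursive_ext; [|apply (@rec_subst m n f g Hf)].
  - intros v. cbv beta. f_equal. apply functional_extensionality. intros i.
    destruct (lt_dec i n) as [Hi|Hi].
    + pose proof (nth_venv (Vector.map (fun h => h (venv v)) g) (Fin.of_nat_lt Hi)) as H.
      rewrite Fin.to_nat_of_nat in H. cbn [proj1_sig] in H. rewrite <- H.
      erewrite Vector.nth_map; [|reflexivity]. rewrite Hg, Fin.to_nat_of_nat. reflexivity.
    + rewrite !venv_default; auto; [apply Hr|]; lia.
  - intros i. rewrite Hg. apply rec_var.
Qed.

Lemma rec_let k (f : nat -> env -> nat) g :
  rec_fn (S k) (fun e => f (e 0) (fun i => e (S i))) -> rec_fn k g -> rec_fn k (fun e => f (g e) e).
Proof.
  intros Hf Hg.
  (* A recursion of [S (g e)] steps that ignores its accumulator returns the value of its last step,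
     which has index [g e]. *)
  pose proof (@rec_nat_rect k (fun _ => 0) (fun i _ e => f i e) (fun e => S (g e))) as H.
  eapply rec_ext; [|apply H]; [reflexivity|auto with recdb| |auto with recdb].
  apply (@rec_rename (S k) (S (S k)) (fun e => f (e 0) (fun i => e (S i)))
    (fun i => match i with 0 => 0 | S j => S (S j) end)); auto.
  intros [|i]; lia.
Qed.

Lemma rec_bmin k (g : env -> nat) (p : nat -> env -> bool) :
  rec_fn k g -> rec_pred (S k) (fun e => p (e 0) (fun i => e (S i))) ->
  rec_fn k (fun e => bmin (g e) (fun i => p i e)).
Proof.
  intros Hg Hp. unfold bmin.
  apply (@rec_nat_rect k (fun _ => 0)
    (fun i r e => if r <? i then r else if p i e then i else S i) g); solve_rec.
  apply rec_if; solve_rec. apply rec_if; solve_rec.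
  apply (@rec_rename (S k) (S (S k)) (fun e => Nat.b2n (p (e 0) (fun i => e (S i))))
    (fun i => match i with 0 => 0 | S j => S (S j) end)); auto.
  intros [|i]; lia.
Qed.

Definition ball (n : nat) (p : nat -> bool) : bool := bmin n (fun i => negb (p i)) =? n.
Definition bex (n : nat) (p : nat -> bool) : bool := bmin n p <? n.

Lemma bex_iff n p : bex n p = true <-> exists i, i < n /\ p i = true.
Proof.
  unfold bex. rewrite Nat.ltb_lt. split.
  - intros H. destruct (bmin_spec n p) as [_ [|[]]]; [lia|eauto].
  - intros (i & Hi & Hp). now apply (bmin_lt (i := i)).
Qed.

Lemma ball_iff n p : ball n p = true <-> forall i, i < n -> p i = true.
Proof.
  unfold ball. rewrite Nat.eqb_eq. split.
  - intros H i Hi. destruct (bmin_spec n (fun i => negb (p i))) as [H1 _].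
    specialize (H1 i). rewrite H in H1. apply negb_false_iff. auto.
  - intros H. destruct (bmin_spec n (fun i => negb (p i))) as [_ [|[H1 H2]]]; auto.
    rewrite H in H2; [discriminate|auto].
Qed.

Lemma rec_ball k (g : env -> nat) (p : nat -> env -> bool) :
  rec_fn k g -> rec_pred (S k) (fun e => p (e 0) (fun i => e (S i))) ->
  rec_pred k (fun e => ball (g e) (fun i => p i e)).
Proof.
  intros Hg Hp. apply rec_eqb; auto.
  apply (@rec_bmin k g (fun i e => negb (p i e))); auto with recdb.
Qed.

Lemma rec_bex k (g : env -> nat) (p : nat -> env -> bool) :
  rec_fn k g -> rec_pred (S k) (fun e => p (e 0) (fun i => e (S i))) ->
  rec_pred k (fun e => bex (g e) (fun i => p i e)).
Proof. intros Hg Hp. apply rec_ltb; auto. now apply rec_bmin. Qed.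

(** Success is shifted by one so that 0 can signal failure. *)
Definition search (n : nat) (p : nat -> bool) (out : nat -> nat) : nat :=
  if bmin (S n) p <=? n then S (out (bmin (S n) p)) else 0.

Lemma search_found n p out i : i <= n -> p i = true -> search n p out <> 0.
Proof.
  intros Hi Hp. unfold search. destruct (@bmin_lt (S n) p i) as [H _]; auto; [lia|].
  destruct (Nat.leb_spec (bmin (S n) p) n); [discriminate|lia].
Qed.

Lemma search_S n p out r : search n p out = S r -> exists i, i <= n /\ p i = true /\ r = out i.
Proof.
  unfold search. destruct (Nat.leb_spec (bmin (S n) p) n) as [H|]; [|discriminate].
  intros E. injection E as <-. exists (bmin (S n) p).
  destruct (bmin_spec (S n) p) as [_ [E|[_ E]]]; [lia|auto].
Qed.

Lemma rec_search k (g : env -> nat) (p : nat -> env -> bool) (out : nat -> env -> nat) :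
  rec_fn k g -> rec_pred (S k) (fun e => p (e 0) (fun i => e (S i))) ->
  rec_fn (S k) (fun e => out (e 0) (fun i => e (S i))) ->
  rec_fn k (fun e => search (g e) (fun i => p i e) (fun i => out i e)).
Proof.
  intros Hg Hp Hout. unfold search.
  assert (Hb : rec_fn k (fun e => bmin (S (g e)) (fun i => p i e))).
  { apply (@rec_bmin k (fun e => S (g e))); auto with recdb. }
  apply rec_if; auto with recdb. apply rec_S.
  apply (@rec_let k out (fun e => bmin (S (g e)) (fun i => p i e))); auto.
Qed.

(** * Cantor pairing and finite sequences *)

Definition pi (x y : nat) : nat := Cantor.to_nat (x, y).
Definition p1 (z : nat) : nat := fst (Cantor.of_nat z).
Definition p2 (z : nat) : nat := snd (Cantor.of_nat z).

Lemma p1_pi x y : p1 (pi x y) = x.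
Proof. unfold p1, pi. now rewrite Cantor.cancel_of_to. Qed.
Lemma p2_pi x y : p2 (pi x y) = y.
Proof. unfold p2, pi. now rewrite Cantor.cancel_of_to. Qed.
Lemma pi_surj z : pi (p1 z) (p2 z) = z.
Proof. unfold p1, p2, pi. now rewrite <- surjective_pairing, Cantor.cancel_to_of. Qed.
Lemma pi_le x y : x <= pi x y /\ y <= pi x y.
Proof. pose proof (Cantor.to_nat_spec x y). unfold pi. nia. Qed.
Lemma p1_le z : p1 z <= z.
Proof. rewrite <- (pi_surj z) at 2. apply pi_le. Qed.
Lemma p2_le z : p2 z <= z.
Proof. rewrite <- (pi_surj z) at 2. apply pi_le. Qed.
Lemma pi_inj x y x' y' : pi x y = pi x' y' -> x = x' /\ y = y'.
Proof.
  intros H. split; [rewrite <- (p1_pi x y), H; apply p1_pi|rewrite <- (p2_pi x y), H; apply p2_pi].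
Qed.

Lemma rec_pi k g h : rec_fn k g -> rec_fn k h -> rec_fn k (fun e => pi (g e) (h e)).
Proof.
  apply (@rec_app2 pi).
  apply rec_ext with
    (fun e => e 1 + nat_rect (fun _ => nat) 0 (fun i m => S (i + m)) (e 1 + e 0)).
  - reflexivity.
  - apply rec_add; solve_rec.
    apply (@rec_nat_rect 2 (fun _ => 0) (fun i m _ => S (i + m)) (fun e => e 1 + e 0)); solve_rec.
Qed.
#[global] Hint Resolve rec_pi : recdb.

(** Both components of a pair are bounded by its code, so the projections are bounded searches. *)
Lemma p1_bmin z : p1 z = bmin z (fun x => bex (S z) (fun y => pi x y =? z)).
Proof.
  destruct (bmin_spec z (fun x => bex (S z) (fun y => pi x y =? z))) as [H1 H2].
  set (b := bmin _ _) in *.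
  assert (Hp : forall x, bex (S z) (fun y => pi x y =? z) = true <-> x = p1 z).
  { intros x. rewrite bex_iff. split.
    - intros (y & _ & Hy). apply Nat.eqb_eq in Hy. now rewrite <- Hy, p1_pi.
    - intros ->. exists (p2 z). rewrite pi_surj, Nat.eqb_refl. pose proof (p2_le z). split; auto; lia. }
  destruct H2 as [E|[_ E]]; [|symmetry; now apply Hp].
  pose proof (p1_le z). destruct (Nat.eq_dec (p1 z) z); [congruence|].
  assert (Hb : bex (S z) (fun y => pi (p1 z) y =? z) = true) by now apply Hp.
  rewrite H1 in Hb; [discriminate|lia].
Qed.

Lemma rec_p1 k g : rec_fn k g -> rec_fn k (fun e => p1 (g e)).
Proof.
  apply (@rec_app1 p1). eapply rec_ext; [intros e; symmetry; apply p1_bmin|].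
  apply (@rec_bmin 1 (fun e => e 0) (fun x e => bex (S (e 0)) (fun y => pi x y =? e 0))); solve_rec.
  apply (@rec_bex 2 (fun e => S (e 1)) (fun y e => pi (e 0) y =? e 1)); solve_rec.
Qed.
#[global] Hint Resolve rec_p1 : recdb.

Lemma rec_p2 k g : rec_fn k g -> rec_fn k (fun e => p2 (g e)).
Proof.
  apply (@rec_app1 p2).
  apply rec_ext with (fun e => bmin (e 0) (fun y => pi (p1 (e 0)) y =? e 0)).
  - intros e. set (z := e 0).
    destruct (bmin_spec z (fun y => pi (p1 z) y =? z)) as [H1 H2].
    set (b := bmin _ _) in *. pose proof (p2_le z).
    assert (Hz : (pi (p1 z) (p2 z) =? z) = true) by now rewrite pi_surj, Nat.eqb_refl.
    destruct H2 as [E|[_ E]].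
    + destruct (Nat.eq_dec (p2 z) z); [congruence|].
      rewrite H1 in Hz; [discriminate|lia].
    + apply Nat.eqb_eq in E. apply (f_equal p2) in E. now rewrite p2_pi in E.
  - apply (@rec_bmin 1 (fun e => e 0) (fun y e => pi (p1 (e 0)) y =? e 0)); solve_rec.
Qed.
#[global] Hint Resolve rec_p2 : recdb.

Lemma rec_iter k (f : nat -> nat) g h :
  (forall k g, rec_fn k g -> rec_fn k (fun e => f (g e))) ->
  rec_fn k g -> rec_fn k h -> rec_fn k (fun e => Nat.iter (g e) f (h e)).
Proof.
  intros Hf Hg Hh.
  apply (@rec_nat_rect k h (fun _ r _ => f r) g); solve_rec.
Qed.

(** [a] codes a finite sequence of length [len a] with entries [at_ a i];
    beyond the length the entries are junk. *)
Definition len (a : nat) : nat := p1 a.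
Definition at_ (a i : nat) : nat := p1 (Nat.iter (len a - S i) p2 (p2 a)).
(** The last entry is outermost, which makes this a primitive recursion in [k] and puts entry [i]
    below [k - S i] later ones. *)
Definition pre (y : nat -> nat) (k : nat) : nat :=
  pi k (nat_rect (fun _ => nat) 0 (fun i r => pi (y i) r) k).

Lemma len_pre y k : len (pre y k) = k.
Proof. apply p1_pi. Qed.

Lemma at_pre y k i : i < k -> at_ (pre y k) i = y i.
Proof.
  intros Hi. unfold at_. rewrite len_pre. unfold pre. rewrite p2_pi.
  assert (H : forall j, Nat.iter j p2
     (nat_rect (fun _ => nat) 0 (fun i r => pi (y i) r) (j + S i)) =
     nat_rect (fun _ => nat) 0 (fun i r => pi (y i) r) (S i)).
  { induction j as [|j IH]; [reflexivity|].
    rewrite Nat.iter_succ_r. simpl plus. simpl nat_rect at 1. rewrite p2_pi. exact IH. }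
  replace k with ((k - S i) + S i) at 2 by lia. rewrite H. apply p1_pi.
Qed.

Lemma at_le a i : at_ a i <= a.
Proof.
  unfold at_. etransitivity; [apply p1_le|].
  induction (len a - S i); simpl; [apply p2_le|].
  etransitivity; [apply p2_le|auto].
Qed.

Lemma len_le a : len a <= a.
Proof. apply p1_le. Qed.

Lemma rec_len k g : rec_fn k g -> rec_fn k (fun e => len (g e)).
Proof. apply rec_p1. Qed.
#[global] Hint Resolve rec_len : recdb.

Lemma rec_at k g h : rec_fn k g -> rec_fn k h -> rec_fn k (fun e => at_ (g e) (h e)).
Proof.
  intros Hg Hh. unfold at_. apply rec_p1, rec_iter; solve_rec.
Qed.
#[global] Hint Resolve rec_at : recdb.

(** * Decoding initial segments *)

Definition slen (q : nat) : nat := bmin q (fun j => Nat.iter j Nat.div2 q <=? 1).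
Definition sbit (q i : nat) : bool := Nat.odd (Nat.iter (slen q - S i) Nat.div2 q).

Lemma iter_div2_segment X j k : Nat.iter j Nat.div2 (segment X (j + k)) = segment X k.
Proof.
  induction j as [|j IH]; [reflexivity|].
  rewrite Nat.iter_succ_r. simpl plus. cbn [segment].
  rewrite Nat.div2_div, Nat.add_comm, Nat.mul_comm, Nat.div_add, Nat.div_small; auto;
    destruct (X (j + k)); simpl; lia.
Qed.

Lemma segment_gt X k : k < segment X k.
Proof. induction k; simpl; lia. Qed.

(** Each halving drops the latest bit, so the number of halvings down to the leading 1 is the
    length. *)
Lemma slen_segment X k : slen (segment X k) = k.
Proof.
  unfold slen. set (p := fun j => _).
  assert (Hk : p k = true).
  { unfold p. replace k with (k + 0) at 2 by lia. rewrite iter_div2_segment. reflexivity. }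
  destruct (bmin_lt (segment_gt X k) Hk) as [H1 H2].
  destruct (bmin_spec (segment X k) p) as [H3 _]. set (b := bmin _ _) in *.
  destruct (lt_eq_lt_dec b k) as [[Hb|Hb]|Hb]; auto.
  - unfold p in H2. replace k with (b + (k - b)) in H2 by lia.
    rewrite iter_div2_segment in H2. apply Nat.leb_le in H2.
    pose proof (segment_gt X (k - b)). lia.
  - rewrite H3 in Hk; [discriminate|auto].
Qed.

Lemma sbit_segment X k i : i < k -> sbit (segment X k) i = X i.
Proof.
  intros Hi. unfold sbit. rewrite slen_segment.
  replace (segment X k) with (segment X ((k - S i) + S i)) by (f_equal; lia).
  rewrite iter_div2_segment. cbn [segment].
  rewrite Nat.odd_add_mul_2 || (rewrite Nat.add_comm, Nat.odd_add_mul_2).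
  destruct (X i); reflexivity.
Qed.

Lemma segment_ext X Y k : (forall i, i < k -> X i = Y i) -> segment X k = segment Y k.
Proof. induction k; intros H; simpl; auto. rewrite H, IHk; auto. Qed.

Lemma rec_odd k g : rec_fn k g -> rec_pred k (fun e => Nat.odd (g e)).
Proof.
  apply (@rec_app1 (fun n => Nat.b2n (Nat.odd n))).
  apply rec_ext with (fun e => nat_rect (fun _ => nat) 0 (fun _ r => 1 - r) (e 0)).
  - intros e. induction (e 0) as [|n IH]; [reflexivity|].
    rewrite Nat.odd_succ, <- Nat.negb_odd.
    etransitivity; [exact (f_equal (Nat.sub 1) IH)|]. destruct (Nat.odd n); reflexivity.
  - apply (@rec_nat_rect 1 (fun _ => 0) (fun _ r _ => 1 - r)); solve_rec.
Qed.

Lemma rec_div2 k g : rec_fn k g -> rec_fn k (fun e => Nat.div2 (g e)).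
Proof.
  apply (@rec_app1 Nat.div2).
  apply rec_ext with
    (fun e => nat_rect (fun _ => nat) 0 (fun n r => r + Nat.b2n (Nat.odd n)) (e 0)).
  - intros e. induction (e 0) as [|n IH]; [reflexivity|].
    etransitivity; [exact (f_equal (fun r => r + Nat.b2n (Nat.odd n)) IH)|].
    pose proof (Nat.div2_odd n). pose proof (Nat.div2_odd (S n)).
    rewrite Nat.odd_succ, <- Nat.negb_odd in H0. destruct (Nat.odd n); simpl Nat.b2n in *; lia.
  - apply (@rec_nat_rect 1 (fun _ => 0) (fun n r _ => r + Nat.b2n (Nat.odd n))); solve_rec.
    apply rec_add; solve_rec. now apply rec_odd, rec_var.
Qed.
#[global] Hint Resolve rec_odd rec_div2 : recdb.

Lemma rec_slen k g : rec_fn k g -> rec_fn k (fun e => slen (g e)).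
Proof.
  apply (@rec_app1 slen).
  apply (@rec_bmin 1 (fun e => e 0) (fun j e => Nat.iter j Nat.div2 (e 0) <=? 1)); solve_rec.
  apply rec_leb; solve_rec. apply rec_iter; solve_rec.
Qed.
#[global] Hint Resolve rec_slen : recdb.

Lemma rec_sbit k g h : rec_fn k g -> rec_fn k h -> rec_pred k (fun e => sbit (g e) (h e)).
Proof.
  intros Hg Hh. apply rec_odd, rec_iter; solve_rec.
Qed.
#[global] Hint Resolve rec_sbit : recdb.

Lemma rec_segment k (X : nat -> env -> bool) g :
  rec_pred (S k) (fun e => X (e 0) (fun i => e (S i))) -> rec_fn k g ->
  rec_fn k (fun e => segment (fun i => X i e) (g e)).
Proof.
  intros HX Hg.
  apply rec_ext with
    (fun e => nat_rect (fun _ => nat) 1 (fun j r => 2 * r + Nat.b2n (X j e)) (g e)).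
  - intros e. induction (g e) as [|n IH]; [reflexivity|].
    exact (f_equal (fun r => 2 * r + Nat.b2n (X n e)) IH).
  - apply (@rec_nat_rect k (fun _ => 1) (fun j r e => 2 * r + Nat.b2n (X j e)) g); solve_rec.
    apply rec_add; solve_rec.
    apply (@rec_rename (S k) (S (S k)) (fun e => Nat.b2n (X (e 0) (fun i => e (S i))))
      (fun i => match i with 0 => 0 | S j => S (S j) end)); auto.
    intros [|i]; lia.
Qed.

(** * Arithmetical predicates *)

Lemma crt_modulus_coprime v i j M :
  j <= M -> i < j -> (forall d, 0 < d <= M -> Nat.divide d v) ->
  Nat.gcd (S (S i * v)) (S (S j * v)) = 1.
Proof.
  intros Hj Hij Hv. set (d := Nat.gcd _ _).
  assert (H1 : Nat.divide d (S (S i * v))) by apply Nat.gcd_divide_l.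
  assert (H2 : Nat.divide d (S (S j * v))) by apply Nat.gcd_divide_r.
  (* By this [d] is coprime to [v], so it divides [j - i]; that is at most [M], hence a divisor of
     [v], and [d] is 1. *)
  assert (Hc : forall e, Nat.divide e d -> Nat.divide e v -> e = 1).
  { intros e He Hev. apply Nat.divide_1_r.
    apply (Nat.divide_add_cancel_r e (S i * v)); [now apply Nat.divide_mul_r|].
    rewrite Nat.add_1_r. now apply Nat.divide_trans with d. }
  assert (H3 : Nat.divide d (v * (j - i))).
  { replace (v * (j - i)) with (S (S j * v) - S (S i * v)) by nia.
    now apply Nat.divide_sub_r. }
  apply Nat.gauss in H3.
  - apply Hc; [apply Nat.divide_refl|].
    apply Nat.divide_trans with (j - i); auto. apply Hv; lia.
  - apply Hc; [apply Nat.gcd_divide_l|apply Nat.gcd_divide_r].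
Qed.

Lemma gcd_mul_1 a b c : Nat.gcd a c = 1 -> Nat.gcd b c = 1 -> Nat.gcd (a * b) c = 1.
Proof.
  intros Ha Hb. apply Nat.divide_1_r. rewrite <- Hb.
  assert (Hd : Nat.divide (Nat.gcd (a * b) c) c) by apply Nat.gcd_divide_r.
  apply Nat.gcd_greatest; auto.
  apply (@Nat.gauss _ a); [apply Nat.gcd_divide_l|].
  apply Nat.divide_1_r. rewrite <- Ha.
  apply Nat.gcd_greatest; [apply Nat.gcd_divide_r|].
  now apply Nat.divide_trans with (2 := Hd), Nat.gcd_divide_l.
Qed.

(** By Bezout [a * P] is 1 modulo [m]; the factor [g + (m - 1) * u] is [g - u] modulo [m] without
    subtraction. *)
Lemma crt_pair u P m g :
  0 < P -> Nat.gcd P m = 1 -> g < m -> exists t, (u + t * P) mod m = g.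
Proof.
  intros HP Hg Hm.
  destruct (Nat.gcd_bezout_pos P m HP) as (a & b & E). rewrite Hg in E.
  exists (a * (g + (m - 1) * u)).
  replace (u + a * (g + (m - 1) * u) * P) with (g + (u + b * (g + (m - 1) * u)) * m).
  - rewrite Nat.Div0.mod_add. now apply Nat.mod_small.
  - replace (a * (g + (m - 1) * u) * P) with ((a * P) * (g + (m - 1) * u)) by ring.
    rewrite E. destruct m; [lia|]. replace (S m - 1) with m by lia. ring.
Qed.

Definition beta (u v i : nat) : nat := u mod (S (S i * v)).

Lemma beta_complete (g : nat -> nat) k : exists u v, forall i, i < k -> beta u v i = g i.
Proof.
  assert (HM : exists M, k <= M /\ forall i, i < k -> g i <= M).
  { induction k as [|k (M & H1 & H2)]; [exists 0; split; intros; lia|].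
    exists (S M + g k). split; [lia|]. intros i Hi.
    destruct (Nat.eq_dec i k); [subst; lia|]. pose proof (H2 i); lia. }
  destruct HM as (M & HkM & HgM).
  assert (Hv : forall d, 0 < d <= M -> Nat.divide d (fact M)).
  { clear. intros d Hd. induction M as [|M IH]; [lia|].
    destruct (Nat.eq_dec d (S M)) as [->|].
    - apply Nat.divide_factor_l.
    - simpl. apply (Nat.divide_add_r d); [|apply Nat.divide_mul_r]; apply IH; lia. }
  (* As [M] bounds the length and all values, its factorial is divisible by every index difference,
     and each modulus exceeds the value it has to hold. *)
  set (v := fact M) in *. set (m := fun i => S (S i * v)).
  assert (HvM : M <= v).
  { destruct M; [lia|]. apply Nat.divide_pos_le; [apply lt_O_fact|apply Hv; lia]. }
  (* Chinese remaindering one modulus at a time: adding multiples of [P] preserves the congruences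
     already solved. *)
  assert (H : forall l, l <= k -> exists u P, 0 < P /\
      (forall i, l <= i < k -> Nat.gcd P (m i) = 1) /\
      forall i, i < l -> u mod m i = g i /\ Nat.divide (m i) P).
  { induction l as [|l IH]; intros Hl.
    - exists 0, 1. repeat split; intros; try lia. 
    - destruct IH as (u & P & HP & Hc & Hu); [lia|].
      assert (Hgl : g l < m l) by (pose proof (HgM l); unfold m; nia).
      destruct (crt_pair u HP (Hc l ltac:(lia)) Hgl) as [t Ht].
      exists (u + t * P), (P * m l). split; [unfold m; nia|]. split.
      + intros i Hi. apply gcd_mul_1; [apply Hc; lia|].
        apply crt_modulus_coprime with M; auto; lia.
      + intros i Hi. destruct (Nat.eq_dec i l) as [->|].
        * split; [exact Ht|apply Nat.divide_factor_r].
        * destruct (Hu i) as [H1 [q H2]]; [lia|]. split.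
          -- rewrite H2, Nat.mul_assoc, Nat.Div0.mod_add. exact H1.
          -- apply Nat.divide_mul_l. now exists q. }
  destruct (H k) as (u & P & _ & _ & Hu); [lia|].
  exists u, v. intros i Hi. now apply Hu.
Qed.

(** * Renaming of variables *)

Fixpoint ren_term (r : nat -> nat) (t : term) : term :=
  match t with
  | Var i => Var (r i)
  | Zero => Zero
  | One => One
  | Add s t => Add (ren_term r s) (ren_term r t)
  | Mul s t => Mul (ren_term r s) (ren_term r t)
  end.

Definition up (r : nat -> nat) (i : nat) : nat := match i with 0 => 0 | S j => S (r j) end.

Fixpoint ren V (r : nat -> nat) (A : formula V) : formula V :=
  match A with
  | Eq s t => Eq (ren_term r s) (ren_term r t)
  | Lt s t => Lt (ren_term r s) (ren_term r t)
  | Mem t P => Mem (ren_term r t) P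
  | Not A => Not (ren r A)
  | And A B => And (ren r A) (ren r B)
  | Or A B => Or (ren r A) (ren r B)
  | Imp A B => Imp (ren r A) (ren r B)
  | Ex A => Ex (ren (up r) A)
  | All A => All (ren (up r) A)
  end.

Lemma eval_ren r t e : eval e (ren_term r t) = eval (fun i => e (r i)) t.
Proof. induction t; simpl; auto. Qed.

Lemma eval_ext k t e e' :
  term_bounded k t -> (forall i, i < k -> e i = e' i) -> eval e t = eval e' t.
Proof. induction t; simpl; intuition. Qed.

Lemma term_bounded_ren k l r t :
  term_bounded k t -> (forall i, i < k -> r i < l) -> term_bounded l (ren_term r t).
Proof. induction t; simpl; intuition. Qed.

Lemma up_lt k l r : (forall i, i < k -> r i < l) -> forall i, i < S k -> up r i < S l.
Proof. intros H [|i] Hi; simpl; [lia|]. specialize (H i). lia. Qed.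

Lemma scons_ext k e e' x :
  (forall i, i < k -> e i = e' i) -> forall i, i < S k -> scons x e i = scons x e' i.
Proof. intros H [|i] Hi; simpl; auto. apply H; lia. Qed.

Lemma scons_up r x e : (fun i => scons x e (up r i)) = scons x (fun i => e (r i)).
Proof. apply functional_extensionality. intros [|i]; reflexivity. Qed.

Lemma bounded_ren V (A : formula V) : forall k l r,
  bounded k A -> (forall i, i < k -> r i < l) -> bounded l (ren r A).
Proof.
  induction A; simpl; intros k l r HA Hr;
    try (destruct HA; split); eauto using term_bounded_ren, up_lt.
Qed.

Lemma sat_ren V (P : V -> real) A : forall r e, sat P e (ren r A) <-> sat P (fun i => e (r i)) A.
Proof.
  induction A; simpl; intros r e; rewrite ?eval_ren; try tauto;
    rewrite ?IHA, ?IHA1, ?IHA2; try tauto.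
  - split; intros [n H]; exists n.
    + apply IHA in H. now rewrite scons_up in H.
    + apply IHA. now rewrite scons_up.
  - split; intros H n; specialize (H n).
    + apply IHA in H. now rewrite scons_up in H.
    + apply IHA. now rewrite scons_up.
Qed.

Lemma sat_ext V (P : V -> real) A : forall k e e',
  bounded k A -> (forall i, i < k -> e i = e' i) -> (sat P e A <-> sat P e' A).
Proof.
  induction A; simpl; intros k e e' HA He.
  - destruct HA as [H1 H2].
    rewrite (eval_ext H1 He), (eval_ext H2 He). tauto.
  - destruct HA as [H1 H2].
    rewrite (eval_ext H1 He), (eval_ext H2 He). tauto.
  - rewrite (eval_ext HA He). tauto.
  - rewrite (IHA k e e'); tauto.
  - destruct HA. rewrite (IHA1 k e e'), (IHA2 k e e'); tauto.
  - destruct HA. rewrite (IHA1 k e e'), (IHA2 k e e'); tauto.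
  - destruct HA. rewrite (IHA1 k e e'), (IHA2 k e e'); tauto.
  - split; intros [n H]; exists n; revert H;
      apply (IHA (S k) (scons n e) (scons n e') HA (scons_ext n He)).
  - split; intros H n; generalize (H n);
      apply (IHA (S k) (scons n e) (scons n e') HA (scons_ext n He)).
Qed.

(** * Closure properties of arithmetical predicates *)

Definition satA (e : env) (A : arith_formula) : Prop :=
  sat (fun v : Empty_set => match v with end) e A.

(** Hiding the formula lets definability follow the shape of a predicate, with no formula written
    down. *)
Definition ar (n : nat) (P : env -> Prop) : Prop :=
  exists A : arith_formula, bounded n A /\ forall e, satA e A <-> P e.

Definition af (n : nat) (f : env -> nat) : Prop :=
  ar (S n) (fun e => e 0 = f (fun i => e (S i))).

Lemma ar_iff n P Q : (forall e, P e <-> Q e) -> ar n P -> ar n Q.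
Proof. intros H (A & HA & E). exists A. split; auto. intros e. now rewrite E. Qed.

Lemma ar_ren n m (P : env -> Prop) (g : env -> env) (r : nat -> nat) :
  (forall i, i < n -> r i < m) -> (forall e i, i < n -> g e i = e (r i)) ->
  ar n P -> ar m (fun e => P (g e)).
Proof.
  intros Hr Hg (A & HA & E). exists (ren r A). split; [eapply bounded_ren; eauto|].
  intros e. rewrite <- E. unfold satA. rewrite sat_ren.
  apply sat_ext with n; auto. intros i Hi. symmetry. auto.
Qed.

Lemma ar_not n P : ar n P -> ar n (fun e => ~ P e).
Proof. intros (A & HA & E). exists (Not A). split; auto. intros e. simpl. now rewrite <- E. Qed.
Lemma ar_and n P Q : ar n P -> ar n Q -> ar n (fun e => P e /\ Q e).
Proof.
  intros (A & HA & E) (B & HB & F). exists (And A B). split; [now split|].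
  intros e. simpl. now rewrite <- E, <- F.
Qed.
Lemma ar_or n P Q : ar n P -> ar n Q -> ar n (fun e => P e \/ Q e).
Proof.
  intros (A & HA & E) (B & HB & F). exists (Or A B). split; [now split|].
  intros e. simpl. now rewrite <- E, <- F.
Qed.
Lemma ar_imp n (P Q : env -> Prop) : ar n P -> ar n Q -> ar n (fun e => P e -> Q e).
Proof.
  intros (A & HA & E) (B & HB & F). exists (Imp A B). split; [now split|].
  intros e. simpl. now rewrite <- E, <- F.
Qed.
Lemma ar_ex n (P : nat -> env -> Prop) :
  ar (S n) (fun e => P (e 0) (fun i => e (S i))) -> ar n (fun e => exists x, P x e).
Proof.
  intros (A & HA & E). exists (Ex A). split; auto. intros e.
  split; intros [x H]; exists x; revert H; apply (E (scons x e)).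
Qed.
Lemma ar_all n (P : nat -> env -> Prop) :
  ar (S n) (fun e => P (e 0) (fun i => e (S i))) -> ar n (fun e => forall x, P x e).
Proof.
  intros (A & HA & E). exists (All A). split; auto. intros e.
  split; intros H x; generalize (H x); apply (E (scons x e)).
Qed.

(** A function with arithmetical graph is eliminated by quantifying over its value. *)
Lemma ar_let n (P : nat -> env -> Prop) f :
  af n f -> ar (S n) (fun e => P (e 0) (fun i => e (S i))) -> ar n (fun e => P (f e) e).
Proof.
  intros Hf HP. apply ar_iff with (fun e => exists x, x = f e /\ P x e).
  - intros e. split; [now intros (x & -> & H)|eauto].
  - apply ar_ex. now apply ar_and.
Qed.

Lemma af_shift n f : af n f -> af (S n) (fun e => f (fun i => e (S i))).
Proof.
  intros Hf. unfold af.
  apply (@ar_ren (S n) (S (S n)) (fun e => e 0 = f (fun i => e (S i)))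
    (fun e i => match i with 0 => e 0 | S j => e (S (S j)) end)
    (fun i => match i with 0 => 0 | S j => S (S j) end)); auto.
  - intros [|i]; lia.
  - intros e [|i]; auto.
Qed.

Lemma ar_term n s t : term_bounded n s -> term_bounded n t -> ar n (fun e => eval e s = eval e t).
Proof. intros Hs Ht. exists (Eq s t). split; [now split|]. intros e. reflexivity. Qed.

Lemma af_var n i : i < n -> af n (fun e => e i).
Proof. intros Hi. apply (@ar_term (S n) (Var 0) (Var (S i))); simpl; lia. Qed.

Fixpoint num (n : nat) : term := match n with 0 => Zero | S k => Add (num k) One end.

Lemma eval_num e n : eval e (num n) = n.
Proof. induction n; simpl; lia. Qed.

Lemma num_bounded k n : term_bounded k (num n).
Proof. induction n; simpl; auto. Qed.

Lemma af_const n c : af n (fun _ => c).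
Proof.
  unfold af. apply ar_iff with (fun e => eval e (Var 0) = eval e (num c)).
  - intros e. now rewrite eval_num.
  - apply ar_term; [simpl; lia|apply num_bounded].
Qed.

Lemma ar_eq n f g : af n f -> af n g -> ar n (fun e => f e = g e).
Proof.
  intros Hf Hg. apply (@ar_let n (fun x e => x = g e) f Hf). exact Hg.
Qed.

Lemma ar_lt n f g : af n f -> af n g -> ar n (fun e => f e < g e).
Proof.
  intros Hf Hg. apply (@ar_let n (fun x e => x < g e) f Hf).
  apply (@ar_let (S n) (fun y e => e 0 < y) (fun e => g (fun i => e (S i)))).
  - now apply af_shift.
  - exists (Lt (Var 1) (Var 0)). simpl. split; [lia|]. intros e; reflexivity.
Qed.

Lemma af_term2 (F : nat -> nat -> nat) :
  ar 3 (fun e => e 0 = F (e 1) (e 2)) ->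
  forall n f g, af n f -> af n g -> af n (fun e => F (f e) (g e)).
Proof.
  intros HF n f g Hf Hg. unfold af.
  apply (@ar_let (S n) (fun x e => e 0 = F x (g (fun i => e (S i)))) (fun e => f (fun i => e (S i)))).
  { now apply af_shift. }
  apply (@ar_let (S (S n)) (fun y e => e 1 = F (e 0) y) (fun e => g (fun i => e (S (S i))))).
  { apply (@af_shift (S n) (fun e => g (fun i => e (S i)))). now apply af_shift. }
  apply (@ar_ren 3 (S (S (S n))) (fun e => e 0 = F (e 1) (e 2))
    (fun e i => match i with 0 => e 2 | 1 => e 1 | _ => e 0 end)
    (fun i => match i with 0 => 2 | 1 => 1 | _ => 0 end)); auto.
  - intros [|[|i]]; lia.
  - intros e [|[|i]]; auto.
Qed.

Lemma af_app1 (F : nat -> nat) :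
  ar 2 (fun e => e 0 = F (e 1)) -> forall n f, af n f -> af n (fun e => F (f e)).
Proof.
  intros HF n f Hf. apply (@af_term2 (fun x _ => F x)) with (g := f); auto.
  apply (@ar_ren 2 3 (fun e => e 0 = F (e 1)) (fun e => e) (fun i => i)); auto.
Qed.

Create HintDb ardb.

Lemma af_add n f g : af n f -> af n g -> af n (fun e => f e + g e).
Proof.
  apply (@af_term2 Nat.add). apply (@ar_term 3 (Var 0) (Add (Var 1) (Var 2))); simpl; lia.
Qed.
Lemma af_mul n f g : af n f -> af n g -> af n (fun e => f e * g e).
Proof.
  apply (@af_term2 Nat.mul). apply (@ar_term 3 (Var 0) (Mul (Var 1) (Var 2))); simpl; lia.
Qed.
Lemma af_S n f : af n f -> af n (fun e => S (f e)).
Proof.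
  apply (@af_app1 S). apply ar_iff with (fun e => eval e (Var 0) = eval e (Add (Var 1) One)).
  - intros e. simpl. now rewrite Nat.add_1_r.
  - apply ar_term; simpl; lia.
Qed.

#[global] Hint Resolve ar_not ar_and ar_or ar_imp ar_ex ar_all ar_eq ar_lt af_const af_add af_mul af_S
  : ardb.
#[global] Hint Extern 1 (af _ (fun e => e ?i)) => apply af_var; lia : ardb.

Ltac solve_ar :=
  cbv beta;
  lazymatch goal with
  | |- ar _ (fun e => _ /\ _) => apply ar_and; solve_ar
  | |- ar _ (fun e => _ \/ _) => apply ar_or; solve_ar
  | |- ar _ (fun e => ~ _) => apply ar_not; solve_ar
  | |- ar _ (fun e => exists x, _) => apply ar_ex; solve_ar
  | |- ar _ (fun e => _ = _ :> nat) => apply ar_eq; solve_ar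
  | |- ar _ (fun e => _ < _) => apply ar_lt; solve_ar
  | |- ar _ (fun e => _ -> _) => first [apply ar_imp | apply ar_all]; solve_ar
  | |- _ => auto 60 with ardb
  end.

Lemma ar_le n f g : af n f -> af n g -> ar n (fun e => f e <= g e).
Proof.
  intros Hf Hg. apply ar_iff with (fun e => f e < S (g e)); [intros; lia|].
  apply ar_lt; auto with ardb.
Qed.
#[global] Hint Resolve ar_le : ardb.

Lemma af_pi n f g : af n f -> af n g -> af n (fun e => pi (f e) (g e)).
Proof.
  apply (@af_term2 pi).
  (* Doubling Cantor's polynomial removes the halving and leaves an equation between terms. *)
  apply ar_iff with (fun e => e 0 * 2 = e 2 * 2 + (e 2 + e 1) * S (e 2 + e 1)).
  - intros e. rewrite <- Cantor.to_nat_spec. unfold pi. split; intros; lia.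
  - solve_ar.
Qed.
#[global] Hint Resolve af_pi : ardb.

Lemma af_app3 (F : nat -> nat -> nat -> nat) :
  ar 4 (fun e => e 0 = F (e 1) (e 2) (e 3)) ->
  forall n f g h, af n f -> af n g -> af n h -> af n (fun e => F (f e) (g e) (h e)).
Proof.
  intros HF n f g h Hf Hg Hh.
  pose proof (@af_app1 (fun z => F (p1 z) (p1 (p2 z)) (p2 (p2 z)))) as H.
  apply ar_iff with (fun e => e 0 = (fun z => F (p1 z) (p1 (p2 z)) (p2 (p2 z)))
    (pi (f (fun i => e (S i))) (pi (g (fun i => e (S i))) (h (fun i => e (S i)))))).
  { intros e. cbv beta. now rewrite !p2_pi, !p1_pi. }
  refine (H _ n (fun e => pi (f e) (pi (g e) (h e))) _); [|auto with ardb]. clear - HF.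
  (* Quantifying over the components needs only the definability of [pi], not that of the
     projections. *)
  apply ar_iff with (fun e => exists x y z, e 1 = pi x (pi y z) /\ e 0 = F x y z).
  - intros e. split.
    + intros (x & y & z & -> & ->). now rewrite !p2_pi, !p1_pi.
    + intros ->. exists (p1 (e 1)), (p1 (p2 (e 1))), (p2 (p2 (e 1))). now rewrite !pi_surj.
  - repeat apply ar_ex. apply ar_and; [solve_ar|].
    apply (@ar_ren 4 5 (fun e => e 0 = F (e 1) (e 2) (e 3))
      (fun e i => match i with 0 => e 3 | 1 => e 2 | 2 => e 1 | _ => e 0 end)
      (fun i => match i with 0 => 3 | 1 => 2 | 2 => 1 | _ => 0 end)); auto.
    + intros [|[|[|i]]]; lia.
    + intros e [|[|[|i]]]; auto.
Qed.

Lemma af_beta n f g h : af n f -> af n g -> af n h -> af n (fun e => beta (f e) (g e) (h e)).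
Proof.
  apply (@af_app3 beta).
  apply ar_iff with (fun e => e 0 < S (S (e 3) * e 2) /\
    exists q, e 1 = S (S (e 3) * e 2) * q + e 0).
  - intros e. unfold beta. split.
    + intros (H & q & Hq). now apply Nat.mod_unique with q.
    + intros ->. split; [apply Nat.mod_upper_bound; lia|].
      exists (e 1 / S (S (e 3) * e 2)). apply Nat.div_mod_eq.
  - solve_ar.
Qed.
#[global] Hint Resolve af_beta : ardb.

(** * A universal arithmetical predicate *)

Definition cd (t c1 c2 : nat) : nat := pi t (pi c1 c2).
Definition tr (c x y : nat) : nat := pi c (pi x y).

(** [tr c x y] records that program [c] maps [x] to [y].  One evaluation step
    derives such a record from the records satisfying [P]; the tags stand for
    zero, successor of the head, head, precomposition with the tail, pairing,
    composition, primitive recursion and minimization. *)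
Definition rule (P : nat -> Prop) (t c1 c2 x y : nat) : Prop :=
  (t = 0 /\ y = 0) \/
  (t = 1 /\ exists a b, x = pi a b /\ y = S a) \/
  (t = 2 /\ exists b, x = pi y b) \/
  (t = 3 /\ exists a b, x = pi a b /\ P (tr c1 b y)) \/
  (t = 4 /\ exists a b, y = pi a b /\ P (tr c1 x a) /\ P (tr c2 x b)) \/
  (t = 5 /\ exists a, P (tr c2 x a) /\ P (tr c1 a y)) \/
  (t = 6 /\ exists n v, x = pi n v /\
     ((n = 0 /\ P (tr c1 v y)) \/
      exists m r, n = S m /\ P (tr (cd t c1 c2) (pi m v) r) /\ P (tr c2 (pi m (pi r v)) y))) \/
  (t = 7 /\ P (tr c1 (pi y x) 0) /\ forall m, m < y -> exists r, P (tr c1 (pi m x) (S r))).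

Definition step (P : nat -> Prop) (z : nat) : Prop :=
  exists t c1 c2 x y, z = tr (cd t c1 c2) x y /\ rule P t c1 c2 x y.

Fixpoint derivation (l : list nat) : Prop :=
  match l with
  | nil => True
  | z :: l => step (fun w => In w l) z /\ derivation l
  end.

(** The least set closed under the rules, given by finite lists because these can be coded by
    numbers inside arithmetic. *)
Definition Ev (z : nat) : Prop := exists l, derivation l /\ In z l.

Lemma tr_inj c x y c' x' y' : tr c x y = tr c' x' y' -> c = c' /\ x = x' /\ y = y'.
Proof. intros H. apply pi_inj in H as [-> H]. apply pi_inj in H as [-> ->]. auto. Qed.

Lemma step_iff P t c1 c2 x y : step P (tr (cd t c1 c2) x y) <-> rule P t c1 c2 x y.
Proof.
  split; [|intros H; now exists t, c1, c2, x, y].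
  intros (t' & c1' & c2' & x' & y' & H & Hr).
  apply tr_inj in H as (H & -> & ->). apply tr_inj in H as (-> & -> & ->). exact Hr.
Qed.

Lemma rule_mono (P Q : nat -> Prop) t c1 c2 x y :
  (forall w, P w -> Q w) -> rule P t c1 c2 x y -> rule Q t c1 c2 x y.
Proof.
  intros HPQ H. unfold rule in *.
  destruct H as [H|[H|[H|[(-> & a & b & H & H1)|[(-> & a & b & H & H1 & H2)|[(-> & a & H1 & H2)|
    [(-> & n & v & H & [[H1 H2]|(m & r & H1 & H2 & H3)])|(-> & H1 & H2)]]]]]]].
  - now left.
  - right; now left.
  - do 2 right; now left.
  - do 3 right; left. split; auto. exists a, b. auto.
  - do 4 right; left. split; auto. exists a, b. auto.
  - do 5 right; left. split; auto. exists a. auto.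
  - do 6 right; left. split; auto. exists n, v. auto.
  - do 6 right; left. split; auto. exists n, v. split; auto. right. exists m, r. auto.
  - do 7 right. split; auto. split; auto. intros m Hm. destruct (H2 m Hm) as [r Hr]. eauto.
Qed.

Lemma step_mono (P Q : nat -> Prop) z : (forall w, P w -> Q w) -> step P z -> step Q z.
Proof.
  intros H (t & c1 & c2 & x & y & E & Hr). exists t, c1, c2, x, y. split; auto.
  eapply rule_mono; eauto.
Qed.

Lemma derivation_app l1 l2 : derivation l1 -> derivation l2 -> derivation (l1 ++ l2).
Proof.
  induction l1 as [|z l1 IH]; simpl; auto. intros [H1 H2] H3. split; auto.
  eapply step_mono; [|exact H1]. intros w Hw. apply in_or_app. auto.
Qed.

Lemma derivation_in l z : derivation l -> In z l -> step Ev z.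
Proof.
  induction l as [|w l IH]; simpl; [tauto|]. intros [H1 H2] [->|H]; auto.
  eapply step_mono; [|exact H1]. intros v Hv. now exists l.
Qed.

Lemma Ev_gather ps : (forall w, In w ps -> Ev w) -> exists l, derivation l /\ incl ps l.
Proof.
  induction ps as [|z ps IH]; intros H.
  - exists nil. split; [exact I|]. intros w [].
  - destruct IH as (l & Hl & Hi); [simpl in H; auto|].
    destruct (H z) as (l' & Hl' & Hz); [now left|].
    exists (l' ++ l). split; [now apply derivation_app|].
    intros w [<-|Hw]; apply in_or_app; auto.
Qed.

(** Only minimization has no fixed number of premises; for it they are collected by induction up to
    [y]. *)
Lemma rule_finite P t c1 c2 x y : rule P t c1 c2 x y ->
  exists ps, (forall w, In w ps -> P w) /\ rule (fun w => In w ps) t c1 c2 x y.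
Proof.
  intros H. unfold rule in H.
  destruct H as [H|[H|[H|[(-> & a & b & H & H1)|[(-> & a & b & H & H1 & H2)|[(-> & a & H1 & H2)|
    [(-> & n & v & H & [[H1 H2]|(m & r & H1 & H2 & H3)])|(-> & H1 & H2)]]]]]]].
  - exists nil. split; [intros w []|unfold rule; tauto].
  - exists nil. split; [intros w []|unfold rule; tauto].
  - exists nil. split; [intros w []|unfold rule; tauto].
  - exists (tr c1 b y :: nil). split; [intros w [<-|[]]; auto|].
    do 3 right; left. split; auto. exists a, b. simpl; auto.
  - exists (tr c1 x a :: tr c2 x b :: nil). split; [intros w [<-|[<-|[]]]; auto|].
    do 4 right; left. split; auto. exists a, b. simpl; auto.
  - exists (tr c2 x a :: tr c1 a y :: nil). split; [intros w [<-|[<-|[]]]; auto|].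
    do 5 right; left. split; auto. exists a. simpl; auto.
  - exists (tr c1 v y :: nil). split; [intros w [<-|[]]; auto|].
    do 6 right; left. split; auto. exists n, v. simpl; auto.
  - exists (tr (cd 6 c1 c2) (pi m v) r :: tr c2 (pi m (pi r v)) y :: nil).
    split; [intros w [<-|[<-|[]]]; auto|].
    do 6 right; left. split; auto. exists n, v. split; auto. right. exists m, r. simpl; auto.
  - assert (H : forall n, n <= y -> exists ps, (forall w, In w ps -> P w) /\
        forall m, m < n -> exists r, In (tr c1 (pi m x) (S r)) ps).
    { induction n as [|n IH]; intros Hn.
      - exists nil. split; [intros w []|intros; lia].
      - destruct IH as (ps & Hp & Hq); [lia|]. destruct (H2 n) as [r Hr]; [lia|].
        exists (tr c1 (pi n x) (S r) :: ps). split.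
        + intros w [<-|Hw]; auto.
        + intros m Hm. destruct (Nat.eq_dec m n) as [->|]; [exists r; now left|].
          destruct (Hq m) as [r' Hr']; [lia|]. exists r'. now right. }
    destruct (H y (le_n y)) as (ps & Hp & Hq).
    exists (tr c1 (pi y x) 0 :: ps). split; [intros w [<-|Hw]; auto|].
    do 7 right. split; auto. split; [now left|].
    intros m Hm. destruct (Hq m Hm) as [r Hr]. exists r. now right.
Qed.

Lemma Ev_iff t c1 c2 x y : Ev (tr (cd t c1 c2) x y) <-> rule Ev t c1 c2 x y.
Proof.
  split.
  - intros (l & Hl & Hz). apply step_iff. now apply derivation_in with l.
  - intros H. apply rule_finite in H as (ps & Hp & Hr).
    destruct (Ev_gather Hp) as (l & Hl & Hi).
    exists (tr (cd t c1 c2) x y :: l). split; [|now left].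
    split; auto. apply step_iff. eapply rule_mono; [|exact Hr]. exact Hi.
Qed.

Ltac ev_rule :=
  rewrite Ev_iff; unfold rule; split;
  [intros H;
   repeat match goal with
   | H : _ \/ _ |- _ => destruct H as [H|H]
   | H : _ /\ _ |- _ => destruct H
   end; try discriminate
  |intros H].

Lemma Ev0 c1 c2 x y : Ev (tr (cd 0 c1 c2) x y) <-> y = 0.
Proof. ev_rule; auto. Qed.
Lemma Ev1 c1 c2 a b y : Ev (tr (cd 1 c1 c2) (pi a b) y) <-> y = S a.
Proof.
  ev_rule.
  - destruct H0 as (a' & b' & E & ->). now apply pi_inj in E as [-> ->].
  - right; left. eauto.
Qed.
Lemma Ev2 c1 c2 a b y : Ev (tr (cd 2 c1 c2) (pi a b) y) <-> y = a.
Proof.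
  ev_rule.
  - destruct H0 as (b' & E). now apply pi_inj in E as [-> ->].
  - do 2 right; left. subst; eauto.
Qed.
Lemma Ev3 c1 c2 a b y : Ev (tr (cd 3 c1 c2) (pi a b) y) <-> Ev (tr c1 b y).
Proof.
  ev_rule.
  - destruct H0 as (a' & b' & E & H'). now apply pi_inj in E as [-> ->].
  - do 3 right; left. eauto.
Qed.
Lemma Ev4 c1 c2 x y : Ev (tr (cd 4 c1 c2) x y) <->
  exists a b, y = pi a b /\ Ev (tr c1 x a) /\ Ev (tr c2 x b).
Proof. ev_rule; auto. do 4 right; left. eauto. Qed.
Lemma Ev5 c1 c2 x y : Ev (tr (cd 5 c1 c2) x y) <->
  exists a, Ev (tr c2 x a) /\ Ev (tr c1 a y).
Proof. ev_rule; auto. do 5 right; left. eauto. Qed.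
Lemma Ev6 c1 c2 n v y : Ev (tr (cd 6 c1 c2) (pi n v) y) <->
  (n = 0 /\ Ev (tr c1 v y)) \/
  exists m r, n = S m /\ Ev (tr (cd 6 c1 c2) (pi m v) r) /\ Ev (tr c2 (pi m (pi r v)) y).
Proof.
  ev_rule.
  - destruct H0 as (n' & v' & E & H'). now apply pi_inj in E as [-> ->].
  - do 6 right; left. split; eauto.
Qed.
Lemma Ev7 c1 c2 x y : Ev (tr (cd 7 c1 c2) x y) <->
  Ev (tr c1 (pi y x) 0) /\ forall m, m < y -> exists r, Ev (tr c1 (pi m x) (S r)).
Proof. ev_rule; auto. do 7 right. auto. Qed.

Fixpoint enc k (v : vec k) : nat :=
  match v with
  | Vector.nil _ => 0
  | Vector.cons _ x _ w => pi x (enc w)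
  end.

Definition computes k (c : nat) (f : vec k -> nat) : Prop :=
  forall v y, Ev (tr c (enc v) y) <-> y = f v.

Lemma computes_vector k m (g : Vector.t (vec k -> nat) m) :
  (forall i, exists c, computes c (Vector.nth g i)) ->
  exists c, computes c (fun v => enc (Vector.map (fun gi => gi v) g)).
Proof.
  induction g as [|g0 m g IH]; intros H.
  - exists (cd 0 0 0). intros v y. apply Ev0.
  - destruct (H Fin.F1) as [c1 H1].
    destruct IH as [c2 H2]; [intros i; apply (H (Fin.FS i))|].
    exists (cd 4 c1 c2). intros v y. rewrite Ev4. split.
    + intros (a & b & -> & Ha & Hb). apply H1 in Ha. apply H2 in Hb. now subst.
    + intros ->. eexists _, _. split; [reflexivity|]. split; [now apply H1|now apply H2].
Qed.

Lemma recursive_computes k (f : vec k -> nat) : recursive f -> exists c, computes c f.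
Proof.
  induction 1 as [k| |k i|k m f g Hf IHf Hg IHg|k f g Hf IHf Hg IHg|k f g Hf IHf Hg].
  - exists (cd 0 0 0). intros v y. apply Ev0.
  - exists (cd 1 0 0). intros v y. apply (Vector.caseS' v). intros a w. apply Ev1.
  - induction i as [k|k i [c IH]].
    + exists (cd 2 0 0). intros v y. apply (Vector.caseS' v). intros a w. apply Ev2.
    + exists (cd 3 c 0). intros v y. apply (Vector.caseS' v). intros a w.
      change (Ev (tr (cd 3 c 0) (pi a (enc w)) y) <-> y = Vector.nth w i).
      rewrite Ev3. apply IH.
  - destruct IHf as [c1 H1]. destruct (computes_vector IHg) as [c2 H2].
    exists (cd 5 c1 c2). intros v y. rewrite Ev5. split.
    + intros (a & Ha & Hy). apply H2 in Ha. subst a. now apply H1.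
    + intros ->. eexists. split; [now apply H2|now apply H1].
  - destruct IHf as [c1 H1], IHg as [c2 H2].
    exists (cd 6 c1 c2). intros v. apply (Vector.caseS' v). clear v. intros n w. simpl.
    induction n as [|n IH]; intros y; rewrite Ev6; split.
    + intros [[_ H]|(m & r & H & _)]; [now apply H1|discriminate].
    + intros ->. left. split; auto. now apply H1.
    + intros [[H _]|(m & r & E & Hr & Hy)]; [discriminate|]. injection E as <-.
      apply IH in Hr. subst r.
      exact (proj1 (H2 (Vector.cons _ n _ (Vector.cons _ _ _ w)) y) Hy).
    + intros ->. right. eexists n, _. split; auto. split; [now apply IH|].
      apply (H2 (Vector.cons _ n _ (Vector.cons _ _ _ w))). reflexivity.
  - destruct IHf as [c1 H1]. exists (cd 7 c1 0).
    intros v y. rewrite Ev7. destruct (Hg v) as [Hz Hm].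
    pose proof (fun m r => H1 (Vector.cons _ m _ v) r) as H1'. simpl in H1'.
    split.
    + intros [H0 H2]. apply H1' in H0.
      (* Before [g v] the value of [f] is not 0; beyond it, minimization would demand a successor at
         [g v]. *)
      destruct (lt_eq_lt_dec y (g v)) as [[H|H]|H]; auto.
      * now apply eq_sym, Hm in H0.
      * destruct (H2 _ H) as [r Hr]. apply H1' in Hr. congruence.
    + intros ->. split; [now apply H1'|]. intros m Hlt.
      destruct (f (Vector.cons _ m _ v)) as [|r] eqn:E; [now apply Hm in E|].
      exists r. now apply H1'.
Qed.

Lemma nth_rev_cons z (l : list nat) i :
  i < length l -> nth i (rev (z :: l)) 0 = nth i (rev l) 0.
Proof. intros H. simpl. apply app_nth1. now rewrite length_rev. Qed.

(** Lists grow at the head, so it is in the reversed list that premises have smaller indices and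
    indices are stable. *)
Lemma derivation_nth l : derivation l -> forall i, i < length l ->
  step (fun w => exists j, j < i /\ w = nth j (rev l) 0) (nth i (rev l) 0).
Proof.
  induction l as [|z l IH]; [simpl; intros; lia|].
  intros [H1 H2] i Hi. simpl in Hi.
  destruct (Nat.eq_dec i (length l)) as [->|Hne].
  - simpl rev at 2. rewrite app_nth2; rewrite length_rev; [|lia]. rewrite Nat.sub_diag.
    eapply step_mono; [|exact H1]. intros w Hw.
    apply in_rev in Hw. apply (In_nth _ _ 0) in Hw as (j & Hj & Hw).
    rewrite length_rev in Hj. exists j. split; auto. now rewrite nth_rev_cons.
  - rewrite nth_rev_cons by lia. eapply step_mono; [|apply IH; auto; lia].
    intros w (j & Hj & ->). exists j. split; auto. rewrite nth_rev_cons; auto; lia.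
Qed.

(** Coding the list by [beta] turns derivability into an arithmetical statement. *)
Lemma Ev_beta z : Ev z <-> exists u v k,
  (forall i, i < k -> exists w, w = beta u v i /\
     step (fun x => exists j, j < i /\ x = beta u v j) w) /\
  exists i, i < k /\ z = beta u v i.
Proof.
  split.
  - intros (l & Hl & Hz).
    destruct (beta_complete (fun i => nth i (rev l) 0) (length l)) as (u & v & H).
    exists u, v, (length l). split.
    + intros i Hi. exists (beta u v i). split; auto. rewrite H by auto.
      eapply step_mono; [|now apply derivation_nth].
      intros w (j & Hj & ->). exists j. split; auto. rewrite H; auto; lia.
    + apply in_rev in Hz. apply (In_nth _ _ 0) in Hz as (i & Hi & <-).
      rewrite length_rev in Hi. exists i. split; auto. symmetry. auto.
  - intros (u & v & k & H & i & Hi & ->).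
    assert (HE : forall j, j <= k -> exists l, derivation l /\
        forall w, (exists i, i < j /\ w = beta u v i) -> In w l).
    { induction j as [|j IH]; intros Hj.
      - exists nil. split; [exact I|]. intros w (i' & Hi' & _). lia.
      - destruct IH as (l & Hl & Hw); [lia|]. destruct (H j) as (w & -> & Hs); [lia|].
        exists (beta u v j :: l). split.
        + split; auto. eapply step_mono; [|exact Hs]. auto.
        + intros w (i' & Hi' & ->). destruct (Nat.eq_dec i' j) as [->|]; [now left|].
          right. apply Hw. exists i'. split; auto. lia. }
    destruct (HE k (le_n k)) as (l & Hl & Hw). exists l. split; auto. apply Hw. eauto.
Qed.

Lemma ar_Ev n f : af n f -> ar n (fun e => Ev (f e)).
Proof.
  intros Hf. apply (@ar_let n (fun x _ => Ev x) f Hf).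
  apply (@ar_ren 1 (S n) (fun e => Ev (e 0)) (fun e => e) (fun i => i)); auto; [lia|].
  clear n f Hf.
  eapply ar_iff; [intros e; symmetry; apply Ev_beta|].
  unfold step, rule, tr, cd.
  solve_ar.
Qed.

(** * Arithmetical graphs of recursive functions *)

Lemma rec_graph_ar (F : nat -> nat) :
  rec_fn 1 (fun e => F (e 0)) -> ar 2 (fun e => e 0 = F (e 1)).
Proof.
  intros HF. apply recursive1_iff, recursive_computes in HF as [c Hc].
  apply ar_iff with (fun e => Ev (tr c (pi (e 1) 0) (e 0))).
  - intros e. apply (Hc (Vector.cons _ (e 1) _ (Vector.nil _))).
  - apply ar_Ev. unfold tr. auto with ardb.
Qed.

Lemma rec_af1 (F : nat -> nat) : rec_fn 1 (fun e => F (e 0)) ->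
  forall n f, af n f -> af n (fun e => F (f e)).
Proof. intros HF. apply af_app1. now apply rec_graph_ar. Qed.

Lemma rec_af2 (F : nat -> nat -> nat) : rec_fn 2 (fun e => F (e 0) (e 1)) ->
  forall n f g, af n f -> af n g -> af n (fun e => F (f e) (g e)).
Proof.
  intros HF n f g Hf Hg.
  apply ar_iff with (fun e => e 0 = (fun z => F (p1 z) (p2 z))
    (pi (f (fun i => e (S i))) (g (fun i => e (S i))))).
  - intros e. now rewrite p1_pi, p2_pi.
  - refine (@rec_af1 (fun z => F (p1 z) (p2 z)) _ n (fun e => pi (f e) (g e)) _);
      [|now apply af_pi].
    apply (@rec_app2 F HF); auto with recdb.
Qed.

Lemma rec_af4 (F : nat -> nat -> nat -> nat -> nat) :
  rec_fn 4 (fun e => F (e 0) (e 1) (e 2) (e 3)) ->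
  forall n f g h l, af n f -> af n g -> af n h -> af n l ->
  af n (fun e => F (f e) (g e) (h e) (l e)).
Proof.
  intros HF n f g h l Hf Hg Hh Hl.
  apply ar_iff with (fun e => e 0 =
    (fun z => F (p1 z) (p1 (p2 z)) (p1 (p2 (p2 z))) (p2 (p2 (p2 z))))
    ((fun e => pi (f e) (pi (g e) (pi (h e) (l e)))) (fun i => e (S i)))).
  - intros e. cbv beta. now rewrite !p2_pi, !p1_pi.
  - refine (@rec_af1 (fun z => F (p1 z) (p1 (p2 z)) (p1 (p2 (p2 z))) (p2 (p2 (p2 z)))) _
      n (fun e => pi (f e) (pi (g e) (pi (h e) (l e)))) _); [|now repeat apply af_pi].
    apply (@rec_app4 F HF); auto with recdb.
Qed.

(** * Building and evaluating witnesses *)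

Definition mix (E O : real) : real := fun x => if Nat.odd x then O (Nat.div2 x) else E (Nat.div2 x).

Lemma mix_even E O i : mix E O (2 * i) = E i.
Proof.
  unfold mix. rewrite Nat.odd_even, Nat.div2_double. reflexivity.
Qed.

Lemma mix_odd E O i : mix E O (2 * i + 1) = O i.
Proof.
  unfold mix. rewrite Nat.odd_odd, Nat.add_1_r, Nat.div2_succ_double. reflexivity.
Qed.

Lemma even_part_mix E O : even_part (mix E O) = E.
Proof. apply functional_extensionality. intros i. apply mix_even. Qed.

Lemma odd_part_mix E O : odd_part (mix E O) = O.
Proof. apply functional_extensionality. intros i. apply mix_odd. Qed.

Definition rows (f : nat -> real) : real := fun z => f (p1 z) (p2 z).

Lemma row_rows f n : row (rows f) n = f n.
Proof.
  apply functional_extensionality. intros i. unfold row, rows.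
  fold (pi n i). now rewrite p1_pi, p2_pi.
Qed.

Definition unary (r : nat) : real := fun t => t <? r.

Lemma starts_with_unary r : starts_with (unary r) r.
Proof.
  unfold unary. split; [intros i Hi; now apply Nat.ltb_lt|apply Nat.ltb_irrefl].
Qed.

Lemma starts_with_inj X a b : starts_with X a -> starts_with X b -> a = b.
Proof.
  intros [H1 H2] [H3 H4]. destruct (lt_eq_lt_dec a b) as [[H|H]|H]; auto.
  - rewrite H3 in H2; congruence.
  - rewrite H1 in H4; congruence.
Qed.

Definition graph_rows (y : nat -> nat) : real := rows (fun i => unary (y i)).

Definition const_map (Z : real) : real := mix (fun _ => true) (fun z => Z (p1 z)).

Lemma maps_to_const Z Y : maps_to (const_map Z) Y Z.
Proof.
  intros n. exists 0. unfold const_map. rewrite even_part_mix, odd_part_mix.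
  repeat split; [intros; lia|]. exact (f_equal Z (p1_pi n (segment Y 0))).
Qed.

(** Witnesses may be arbitrary reals: a true implication is witnessed by a constant map, or by any
    real if its premise is false, and a true universal formula by choice. Hence negation means
    classical falsity. *)
Lemma witness_iff_true A : forall e, (exists X, witness e A X) <-> satA e A.
Proof.
  unfold satA. induction A; simpl; intros e.
  - split; [now intros []|]. now exists (fun _ => true).
  - split; [now intros []|]. now exists (fun _ => true).
  - destruct P.
  - rewrite <- IHA. split; [now intros []|]. now exists (fun _ => true).
  - rewrite <- IHA1, <- IHA2. split.
    + intros (X & H1 & H2). eauto.
    + intros [[X HX] [Y HY]]. exists (mix X Y). now rewrite even_part_mix, odd_part_mix.
  - rewrite <- IHA1, <- IHA2. split.
    + intros (X & H). destruct (X 0); eauto.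
    + intros [[X HX]|[X HX]];
        [exists (fun i => match i with 0 => false | S j => X j end)
        |exists (fun i => match i with 0 => true | S j => X j end)]; exact HX.
  - rewrite <- IHA1, <- IHA2. split.
    + intros (X & H) (Y & HY). destruct (H Y HY) as (Z & _ & HZ). eauto.
    + intros H. destruct (classic (exists Y, witness e A1 Y)) as [HY|HY].
      * destruct (H HY) as [Z HZ]. exists (const_map Z). intros Y _. exists Z.
        split; auto using maps_to_const.
      * exists (fun _ => true). intros Y HY'. exfalso; eauto.
  - split.
    + intros (X & n & _ & H). exists n. rewrite <- IHA. eauto.
    + intros [n H]. apply IHA in H as [X HX].
      exists (fun i => if i <? n then true else if i =? n then false else X (i - S n)), n.
      split.
      * split; [intros i Hi; apply Nat.ltb_lt in Hi; now rewrite Hi|].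
        now rewrite Nat.ltb_irrefl, Nat.eqb_refl.
      * match goal with |- witness _ _ ?Z => replace Z with X; auto end.
        apply functional_extensionality. intros i. unfold shift.
        destruct (Nat.ltb_spec (S n + i) n); [lia|].
        destruct (Nat.eqb_spec (S n + i) n); [lia|]. f_equal. lia.
  - split.
    + intros (X & H) n. apply IHA. eauto.
    + intros H.
      assert (H' : forall n, exists X, witness (scons n e) A X) by (intros n; apply IHA, H).
      exists (rows (fun n => proj1_sig (constructive_indefinite_description _ (H' n)))).
      intros n. rewrite row_rows. apply proj2_sig.
Qed.

(* Double negation erases the computational content. *)
Lemma ar_contentless k P : ar k P ->
  exists A : arith_formula, bounded k A /\ forall e X, witness e A X <-> P e.
Proof.
  intros H. apply ar_not in H as (A & HA & E).
  exists (Not A). split; auto. intros e X.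
  change (~ (exists Y, witness e A Y) <-> P e). rewrite witness_iff_true, E. tauto.
Qed.

(** The map with [g n q = 0] as long as the segment [q] does not determine
    output bit [n], and [1] or [2] when that bit is [false] or [true]. *)
Definition tab (g : nat -> nat -> nat) : real :=
  mix (fun z => 0 <? g (p1 z) (p2 z)) (fun z => 1 <? g (p1 z) (p2 z)).

Lemma maps_to_tab g X Y :
  (forall n, exists k, (forall j, j < k -> g n (segment X j) = 0) /\
     g n (segment X k) = S (Nat.b2n (Y n))) ->
  maps_to (tab g) X Y.
Proof.
  intros H n. destruct (H n) as (k & H1 & H2). exists k.
  unfold tab. rewrite even_part_mix, odd_part_mix.
  assert (E : forall j, g (p1 (Cantor.to_nat (n, segment X j))) (p2 (Cantor.to_nat (n, segment X j)))
    = g n (segment X j)).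
  { intros j. fold (pi n (segment X j)). now rewrite p1_pi, p2_pi. }
  split; [|split].
  - intros j Hj. rewrite E, H1; auto.
  - rewrite E, H2. reflexivity.
  - rewrite E, H2. destruct (Y n); reflexivity.
Qed.

Lemma rec_mix k (E O : nat -> env -> bool) x :
  rec_pred (S k) (fun e => E (e 0) (fun i => e (S i))) ->
  rec_pred (S k) (fun e => O (e 0) (fun i => e (S i))) ->
  rec_fn k x -> rec_pred k (fun e => mix (fun i => E i e) (fun i => O i e) (x e)).
Proof.
  intros HE HO Hx. unfold mix. apply rec_ifb; auto with recdb.
  - apply (@rec_let k (fun i e => Nat.b2n (O i e)) (fun e => Nat.div2 (x e))); auto with recdb.
  - apply (@rec_let k (fun i e => Nat.b2n (E i e)) (fun e => Nat.div2 (x e))); auto with recdb.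
Qed.

Lemma recursive_tab g : rec_fn 2 (fun e => g (e 0) (e 1)) -> recursive_real (tab g).
Proof.
  intros Hg. apply recursive1_iff.
  apply (@rec_mix 1 (fun z _ => 0 <? g (p1 z) (p2 z)) (fun z _ => 1 <? g (p1 z) (p2 z)) (fun e => e 0));
    auto with recdb; apply rec_ltb; auto with recdb; apply (rec_app2 Hg); auto with recdb.
Qed.

(** Bit [n] of [unary r] in the three-valued format of [tab]; [s] is 0 while the number is unknown
    and [S r] once it is found. *)
Definition answer (n s : nat) : nat :=
  if s =? 0 then 0 else if n <? pred s then 2 else 1.

Lemma answer_S n r : answer n (S r) = S (Nat.b2n (n <? r)).
Proof. unfold answer. simpl. destruct (n <? r); reflexivity. Qed.

Lemma rec_answer k g h : rec_fn k g -> rec_fn k h -> rec_fn k (fun e => answer (g e) (h e)).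
Proof. intros Hg Hh. unfold answer. apply rec_if; auto 10 with recdb. Qed.
#[global] Hint Resolve rec_answer : recdb.

Lemma first_nonzero (h : nat -> nat) k : h k <> 0 ->
  exists k0 r, k0 <= k /\ (forall j, j < k0 -> h j = 0) /\ h k0 = S r.
Proof.
  induction k as [k IH] using lt_wf_ind. intros Hk.
  destruct (classic (exists j, j < k /\ h j <> 0)) as [(j & Hj & H)|H].
  - destruct (IH j Hj H) as (k0 & r & H1 & H2). exists k0, r. split; [lia|auto].
  - exists k. destruct (h k) as [|r] eqn:E; [easy|]. exists r. repeat split; auto.
    intros j Hj. destruct (Nat.eq_dec (h j) 0); auto. exfalso; eauto.
Qed.

(** All bits are answered at the same first segment, so they agree on one [r] even if [h] gives
    other values on longer segments. *)
Lemma maps_to_unary (h : nat -> nat) X k : h (segment X k) <> 0 ->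
  exists k0 r, h (segment X k0) = S r /\
    maps_to (tab (fun n q => answer n (h q))) X (unary r).
Proof.
  intros H. destruct (@first_nonzero (fun k => h (segment X k)) k H) as (k0 & r & _ & H1 & H2).
  exists k0, r. split; auto. apply maps_to_tab. intros n. exists k0. split.
  - intros j Hj. rewrite H1; auto.
  - rewrite H2. apply answer_S.
Qed.

Lemma maps_to_rows (h : nat -> nat -> nat) X :
  (forall m, exists k, h m (segment X k) <> 0) ->
  exists r : nat -> nat, (forall m, exists k, h m (segment X k) = S (r m)) /\
    maps_to (tab (fun n q => answer (p2 n) (h (p1 n) q))) X (graph_rows r).
Proof.
  intros H.
  assert (H' : forall m, exists r, exists k,
    (forall j, j < k -> h m (segment X j) = 0) /\ h m (segment X k) = S r).
  { intros m. destruct (H m) as [k Hk].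
    destruct (@first_nonzero (fun k => h m (segment X k)) k Hk) as (k0 & r & _ & H1 & H2). eauto. }
  set (r := fun m => proj1_sig (constructive_indefinite_description _ (H' m))).
  assert (Hr : forall m, exists k,
    (forall j, j < k -> h m (segment X j) = 0) /\ h m (segment X k) = S (r m)).
  { intros m. apply (proj2_sig (constructive_indefinite_description _ (H' m))). }
  exists r. split.
  - intros m. destruct (Hr m) as (k & _ & Hk). eauto.
  - apply maps_to_tab. intros n. destruct (Hr (p1 n)) as (k & H1 & H2).
    exists k. split.
    + intros j Hj. rewrite H1; auto.
    + rewrite H2. apply answer_S.
Qed.

(** [W], applied to [rho], yields a real starting with [r] ones and a zero, and
    these bits are determined by segments of [rho] of length at most [l]. *)
Definition outputs (W rho : real) (r l : nat) : Prop :=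
  forall t, t <= r -> exists k, k <= l /\
    (forall j, j < k -> W (2 * pi t (segment rho j)) = false) /\
    W (2 * pi t (segment rho k)) = true /\
    W (2 * pi t (segment rho k) + 1) = (t <? r).

Lemma outputs_ext W rho rho' r l :
  (forall i, i < l -> rho i = rho' i) -> outputs W rho r l -> outputs W rho' r l.
Proof.
  intros E H t Ht. destruct (H t Ht) as (k & Hk & H1 & H2 & H3). exists k.
  assert (E' : forall j, j <= k -> segment rho' j = segment rho j).
  { intros j Hj. apply segment_ext. intros i Hi. symmetry. apply E. lia. }
  split; auto. rewrite E'; auto. split; auto.
  intros j Hj. rewrite E'; [auto|lia].
Qed.

(** Only [r + 1] output bits matter, and each is settled by a finite segment. *)
Lemma maps_to_outputs W rho Y r : maps_to W rho Y -> starts_with Y r -> exists l, outputs W rho r l.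
Proof.
  intros HW [H1 H2].
  assert (H : forall s, s <= S r -> exists l, forall t, t < s -> exists k, k <= l /\
    (forall j, j < k -> W (2 * pi t (segment rho j)) = false) /\
    W (2 * pi t (segment rho k)) = true /\
    W (2 * pi t (segment rho k) + 1) = (t <? r)).
  { induction s as [|s IH]; intros Hs.
    - exists 0. intros; lia.
    - destruct IH as [l Hl]; [lia|]. destruct (HW s) as (k & K1 & K2 & K3).
      exists (l + k). intros t Ht. destruct (Nat.eq_dec t s) as [->|].
      + exists k. split; [lia|]. repeat split; auto.
        unfold odd_part in K3. unfold pi. rewrite K3.
        destruct (Nat.ltb_spec s r); [auto|]. now replace s with r by lia.
      + destruct (Hl t) as (k' & Hk' & H'); [lia|]. exists k'. split; [lia|auto]. }
  destruct (H (S r) (le_n _)) as [l Hl]. exists l. intros t Ht. apply Hl. lia.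
Qed.

(** The first segment that answers a bit is unique, so the finite run and the full map agree. *)
Lemma outputs_maps_to W rho Y r l : outputs W rho r l -> maps_to W rho Y -> starts_with Y r.
Proof.
  intros HO HW.
  assert (H : forall t, t <= r -> Y t = (t <? r)).
  { intros t Ht. destruct (HO t Ht) as (k & _ & H1 & H2 & H3).
    destruct (HW t) as (k' & H1' & H2' & H3').
    unfold even_part, odd_part in *. unfold pi in *.
    assert (k = k') as ->.
    { destruct (lt_eq_lt_dec k k') as [[H|H]|H]; auto.
      - rewrite H1' in H2; [discriminate|auto].
      - rewrite H1 in H2'; [discriminate|auto]. }
    congruence. }
  split.
  - intros i Hi. rewrite H by lia. now apply Nat.ltb_lt.
  - rewrite H by lia. apply Nat.ltb_irrefl.
Qed.

(** * Finite simulation of continuous maps *)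

Definition reads (q i : nat) (b : bool) : bool := (i <? slen q) && Bool.eqb (sbit q i) b.

(** Decidable form of [outputs] for a functional known only through a segment [q] of a larger real,
    in which its bit [i] stands at [pos i]. *)
Definition simulates (q : nat) (pos : nat -> nat) (rho : real) (r l : nat) : bool :=
  ball (S r) (fun t => bex (S l) (fun k =>
    ball k (fun j => reads q (pos (2 * pi t (segment rho j))) false) &&
    reads q (pos (2 * pi t (segment rho k))) true &&
    reads q (pos (2 * pi t (segment rho k) + 1)) (t <? r))).

Lemma reads_segment Z n i b : reads (segment Z n) i b = true <-> i < n /\ Z i = b.
Proof.
  unfold reads. rewrite slen_segment, andb_true_iff, Nat.ltb_lt, eqb_true_iff.
  split; intros [H1 H2]; split; auto; rewrite sbit_segment in *; auto.
Qed.

Lemma simulates_sound Z n pos rho r l : simulates (segment Z n) pos rho r l = true ->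
  outputs (fun i => Z (pos i)) rho r l.
Proof.
  unfold simulates. rewrite ball_iff. intros H t Ht.
  specialize (H t ltac:(lia)). apply bex_iff in H as (k & Hk & H).
  rewrite !andb_true_iff, ball_iff, !reads_segment in H. destruct H as [[H1 H2] H3].
  exists k. split; [lia|]. split; [|tauto].
  intros j Hj. apply H1 in Hj. apply reads_segment in Hj. tauto.
Qed.

Lemma bounded_values (f : nat -> nat -> nat) a b :
  exists M, forall i j, i < a -> j < b -> f i j < M.
Proof.
  assert (H1 : forall (g : nat -> nat) b, exists M, forall j, j < b -> g j < M).
  { intros g c. induction c as [|c [M IH]]; [exists 0; intros; lia|].
    exists (M + S (g c)). intros j Hj. destruct (Nat.eq_dec j c) as [->|]; [lia|].
    specialize (IH j); lia. }
  induction a as [|a [M IH]]; [exists 0; intros; lia|].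
  destruct (H1 (f a) b) as [M' HM']. exists (M + M'). intros i j Hi Hj.
  destruct (Nat.eq_dec i a) as [->|]; [specialize (HM' j); lia|].
  specialize (IH i j); lia.
Qed.

(** The run consults finitely many positions, and any segment beyond all of them suffices. *)
Lemma simulates_complete Z pos rho r l : outputs (fun i => Z (pos i)) rho r l ->
  exists n0, forall n, n0 <= n -> simulates (segment Z n) pos rho r l = true.
Proof.
  intros H.
  destruct (bounded_values (fun t k => pos (2 * pi t (segment rho k))) (S r) (S l)) as [M1 H1].
  destruct (bounded_values (fun t k => pos (2 * pi t (segment rho k) + 1)) (S r) (S l)) as [M2 H2].
  exists (M1 + M2). intros n Hn. apply ball_iff. intros t Ht. apply bex_iff.
  destruct (H t ltac:(lia)) as (k & Hk & K1 & K2 & K3).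
  exists k. split; [lia|]. rewrite !andb_true_iff, ball_iff, !reads_segment.
  specialize (H1 t). specialize (H2 t). cbv beta in *.
  repeat split; auto.
  - intros j Hj. apply reads_segment. split; [specialize (H1 j); lia|auto].
  - specialize (H1 k); lia.
  - specialize (H2 k); lia.
Qed.

Lemma rec_reads k g h b :
  rec_fn k g -> rec_fn k h -> rec_pred k b -> rec_pred k (fun e => reads (g e) (h e) (b e)).
Proof. intros. unfold reads. auto 10 with recdb. Qed.
#[global] Hint Resolve rec_reads : recdb.

Lemma rec_simulates k (pos : nat -> env -> nat) (rho : nat -> env -> bool) q r l :
  rec_fn (S k) (fun e => pos (e 0) (fun i => e (S i))) ->
  rec_pred (S k) (fun e => rho (e 0) (fun i => e (S i))) ->
  rec_fn k q -> rec_fn k r -> rec_fn k l ->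
  rec_pred k (fun e => simulates (q e) (fun i => pos i e) (fun i => rho i e) (r e) (l e)).
Proof.
  intros Hpos0 Hrho0 Hq Hr Hl. unfold simulates.
  (* Bounded quantifiers push the parameters of [pos] and [rho] deeper; [s] gives their new
     positions. *)
  assert (Hgen : forall f : nat -> env -> nat, rec_fn (S k) (fun e => f (e 0) (fun i => e (S i))) ->
    forall k' (s : nat -> nat) y, (forall i, k <= i -> k' <= s i) -> rec_fn k' y ->
    rec_fn k' (fun e => f (y e) (fun i => e (s i)))).
  { intros f Hf k' s y Hs Hy.
    apply (@rec_let k' (fun i e => f i (fun i => e (s i)))); auto.
    apply (@rec_rename (S k) (S k') (fun e => f (e 0) (fun i => e (S i)))
      (fun i => match i with 0 => 0 | S j => S (s j) end)); auto.
    intros [|i] Hi; [lia|]. specialize (Hs i). lia. }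
  pose proof (Hgen pos Hpos0) as Hpos.
  pose proof (Hgen (fun i e => Nat.b2n (rho i e)) Hrho0) as Hrho.
  apply (@rec_ball k (fun e => S (r e))
    (fun t e => bex (S (l e)) (fun k0 =>
      ball k0 (fun j => reads (q e) (pos (2 * pi t (segment (fun i => rho i e) j)) e) false) &&
      reads (q e) (pos (2 * pi t (segment (fun i => rho i e) k0)) e) true &&
      reads (q e) (pos (2 * pi t (segment (fun i => rho i e) k0) + 1) e) (t <? r e))));
    auto with recdb.
  apply (@rec_bex (S k) (fun e => S (l (fun i => e (S i))))
    (fun k0 e =>
      ball k0 (fun j => reads (q (fun i => e (S i)))
        (pos (2 * pi (e 0) (segment (fun i => rho i (fun i => e (S i))) j)) (fun i => e (S i))) false) &&
      reads (q (fun i => e (S i)))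
        (pos (2 * pi (e 0) (segment (fun i => rho i (fun i => e (S i))) k0)) (fun i => e (S i))) true &&
      reads (q (fun i => e (S i)))
        (pos (2 * pi (e 0) (segment (fun i => rho i (fun i => e (S i))) k0) + 1) (fun i => e (S i)))
        (e 0 <? r (fun i => e (S i))))).
  - apply rec_S. apply (@rec_rename k (S k) l S); auto. lia.
  - assert (Hren : forall f, rec_fn k f -> rec_fn (S (S k)) (fun e => f (fun i => e (S (S i))))).
    { intros f Hf. apply (@rec_rename k (S (S k)) f (fun i => S (S i))); auto. lia. }
    assert (Hseg : forall k' (s : nat -> nat) y, (forall i, k <= i -> k' <= s i) -> rec_fn k' y ->
      rec_fn k' (fun e => segment (fun i => rho i (fun i => e (s i))) (y e))).
    { intros k' s y Hs Hy.
      apply (@rec_segment k' (fun i e => rho i (fun i => e (s i)))); auto.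
      apply (Hrho (S k') (fun i => S (s i)) (fun e => e 0)); auto with recdb.
      intros i Hi. specialize (Hs i Hi). lia. }
    apply rec_andb; [apply rec_andb|].
    + apply (@rec_ball (S (S k)) (fun e => e 0) (fun j e => reads (q (fun i => e (S (S i))))
        (pos (2 * pi (e 1) (segment (fun i => rho i (fun i => e (S (S i)))) j))
          (fun i => e (S (S i)))) false)); auto with recdb.
      apply rec_reads; auto with recdb.
      * apply (@rec_rename k (S (S (S k))) q (fun i => S (S (S i)))); auto. lia.
      * apply (Hpos (S (S (S k))) (fun i => S (S (S i)))); [lia|].
        apply rec_mul; auto with recdb. apply rec_pi; auto with recdb.
        apply (Hseg (S (S (S k))) (fun i => S (S (S i)))); auto with recdb. lia.
      * apply (@rec_const _ 0).
    + apply rec_reads; auto with recdb.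
      * apply (Hpos (S (S k)) (fun i => S (S i))); [lia|].
        apply rec_mul; auto with recdb. apply rec_pi; auto with recdb.
        apply (Hseg (S (S k)) (fun i => S (S i))); auto with recdb. lia.
      * apply (@rec_const _ 1).
    + apply rec_reads; auto with recdb.
      * apply (Hpos (S (S k)) (fun i => S (S i))); [lia|]. apply rec_add; auto with recdb.
        apply rec_mul; auto with recdb. apply rec_pi; auto with recdb.
        apply (Hseg (S (S k)) (fun i => S (S i))); auto with recdb. lia.
Qed.

(** * Injectivity of Gödel numbers *)

Lemma term_code_inj s : forall t, term_code s = term_code t -> s = t.
Proof.
  induction s; intros []; simpl; intros H; apply pi_inj in H as [H0 H]; try discriminate; auto.
  - apply pi_inj in H as [H1 H2]. f_equal; auto.
  - apply pi_inj in H as [H1 H2]. f_equal; auto.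
Qed.

Lemma godel_inj A : forall B, godel A = godel B -> A = B.
Proof.
  induction A; intros []; simpl; try destruct P; intros H; apply pi_inj in H as [H0 H];
    try discriminate; try (apply pi_inj in H as [H1 H2]); f_equal; auto using term_code_inj.
Qed.

(** * Normal form for the arithmetical matrix *)

Definition agree (k a : nat) (g : nat -> nat) : Prop := forall i, i < k -> at_ a i = g i.

Lemma agree_pre k g : agree k (pre g k) g.
Proof. intros i Hi. now apply at_pre. Qed.

Definition real_of (g : nat -> nat) : real := fun i => negb (g i =? 0).

Lemma real_of_b2n (X : real) : real_of (fun i => Nat.b2n (X i)) = X.
Proof. apply functional_extensionality. intros i. unfold real_of. destruct (X i); reflexivity. Qed.

(** A Sigma^1_1 normal form relative to [g] and [h]: [f] collects Skolem functions, and any failure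
    of [f] shows on finite initial segments. *)
Definition skolem_form (d : nat) (Q : env -> (nat -> nat) -> (nat -> nat) -> Prop) : Prop :=
  exists K : nat -> nat -> nat -> nat -> env -> Prop,
    ar (4 + d) (fun e => K (e 0) (e 1) (e 2) (e 3) (fun i => e (4 + i))) /\
    forall e g h, Q e g h <-> exists f, forall k a b c,
      agree k a g -> agree k b h -> agree k c f -> ~ K k a b c e.

Lemma skolem_iff d Q Q' :
  (forall e g h, Q e g h <-> Q' e g h) -> skolem_form d Q -> skolem_form d Q'.
Proof. intros H (K & HK & E). exists K. split; auto. intros e g h. now rewrite <- H. Qed.

Lemma ar_weaken d j (P : env -> Prop) : ar d P -> ar (j + d) (fun e => P (fun i => e (j + i))).
Proof.
  apply (@ar_ren d (j + d) P (fun e i => e (j + i)) (fun i => j + i)); auto. lia.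
Qed.

Lemma skolem_pure d P : ar d P -> skolem_form d (fun e _ _ => P e).
Proof.
  intros HP. exists (fun _ _ _ _ e => ~ P e). split.
  - apply ar_not. exact (@ar_weaken d 4 P HP).
  - intros e g h. split.
    + intros H. exists (fun _ => 0). tauto.
    + intros [f H]. apply NNPP.
      apply (H 0 0 0 0); intros i Hi; lia.
Qed.

Lemma eval_af d t : term_bounded d t -> af d (fun e => eval e t).
Proof.
  intros Ht. unfold af.
  apply ar_iff with (fun e => eval e (Var 0) = eval e (ren_term S t)).
  - intros e. now rewrite eval_ren.
  - apply ar_term; [simpl; lia|]. apply term_bounded_ren with d; auto. lia.
Qed.

Lemma af_at n f g : af n f -> af n g -> af n (fun e => at_ (f e) (g e)).
Proof. apply rec_af2. auto with recdb. Qed.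
Lemma af_len n f : af n f -> af n (fun e => len (f e)).
Proof. apply rec_af1. auto with recdb. Qed.
Lemma af_p1 n f : af n f -> af n (fun e => p1 (f e)).
Proof. apply rec_af1. auto with recdb. Qed.
Lemma af_p2 n f : af n f -> af n (fun e => p2 (f e)).
Proof. apply rec_af1. auto with recdb. Qed.
#[global] Hint Resolve af_at af_len af_p1 af_p2 : ardb.

(** Here [val] stands for the identity or negation, and [K] waits until the segments cover the
    queried position. *)
Lemma skolem_mem d (side : bool) (val : Prop -> Prop) t :
  (forall P n, ar n P -> ar n (fun e => val (P e))) ->
  (forall P P', (P <-> P') -> (val P <-> val P')) ->
  term_bounded d t ->
  skolem_form d (fun e g h => val ((if side then h else g) (eval e t) <> 0)).
Proof.
  intros Har Hval Ht.
  assert (Ht' : af (4 + d) (fun e => eval (fun i => e (4 + i)) t)).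
  { unfold af.
    apply (@ar_ren (S d) (S (4 + d)) (fun e => e 0 = eval (fun i => e (S i)) t)
      (fun e i => match i with 0 => e 0 | S j => e (S (4 + j)) end)
      (fun i => match i with 0 => 0 | S j => S (4 + j) end)).
    - intros [|i]; lia.
    - intros e [|i]; auto.
    - now apply eval_af. }
  exists (fun k a b c e => eval e t < k /\ ~ val (at_ (if side then b else a) (eval e t) <> 0)).
  split.
  - apply ar_and; [apply ar_lt; auto with ardb; apply af_var; lia|].
    apply ar_not. apply (Har (fun e =>
      at_ (if side then e 2 else e 1) (eval (fun i => e (4 + i)) t) <> 0)).
    apply ar_not, ar_eq; auto with ardb. apply af_at; auto.
    destruct side; apply af_var; lia.
  - intros e g h. split.
    + intros H. exists (fun _ => 0). intros k a b c Ha Hb _ [Hk Hn]. apply Hn.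
      revert H. apply Hval. destruct side; [rewrite Hb|rewrite Ha]; tauto.
    + intros [f H]. apply NNPP. intros Hn.
      set (k := S (eval e t)).
      apply (H k (pre g k) (pre h k) (pre f k)); auto using agree_pre.
      split; [unfold k; lia|]. intros H'. apply Hn. revert H'. apply Hval.
      destruct side; rewrite at_pre; unfold k; tauto || lia.
Qed.

(** Quantifying over the case index reduces conjunction and disjunction to the number
    quantifiers. *)
Lemma skolem_case d Q1 Q2 : skolem_form d Q1 -> skolem_form d Q2 ->
  skolem_form (S d) (fun e => if e 0 =? 0 then Q1 (fun i => e (S i)) else Q2 (fun i => e (S i))).
Proof.
  intros (K1 & H1 & E1) (K2 & H2 & E2).
  exists (fun k a b c e => (e 0 = 0 /\ K1 k a b c (fun i => e (S i))) \/
                           (e 0 <> 0 /\ K2 k a b c (fun i => e (S i)))).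
  split.
  - assert (H : forall K : nat -> nat -> nat -> nat -> env -> Prop,
      ar (4 + d) (fun e => K (e 0) (e 1) (e 2) (e 3) (fun i => e (4 + i))) ->
      ar (4 + S d) (fun e => K (e 0) (e 1) (e 2) (e 3) (fun i => e (4 + S i)))).
    { intros K. apply (@ar_ren (4 + d) (4 + S d)
        (fun e => K (e 0) (e 1) (e 2) (e 3) (fun i => e (4 + i)))
        (fun e i => match i with 0 => e 0 | 1 => e 1 | 2 => e 2 | 3 => e 3 | S j => e (S (S j)) end)
        (fun i => match i with 0 => 0 | 1 => 1 | 2 => 2 | 3 => 3 | S j => S (S j) end)).
      - intros [|[|[|[|i]]]]; lia.
      - intros e [|[|[|[|i]]]]; auto. }
    assert (H0 : ar (4 + S d) (fun e => e 4 = 0)).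
    { apply ar_eq; auto with ardb. }
    apply ar_or; apply ar_and; auto with ardb.
  - intros e g h. destruct (Nat.eqb_spec (e 0) 0) as [H0|H0].
    + rewrite E1. split; intros [f H]; exists f; intros k a b c Ha Hb Hc.
      * intros [[_ HK]|[H' _]]; [exact (H _ _ _ _ Ha Hb Hc HK)|auto].
      * intros HK. apply (H _ _ _ _ Ha Hb Hc). auto.
    + rewrite E2. split; intros [f H]; exists f; intros k a b c Ha Hb Hc.
      * intros [[H' _]|[_ HK]]; [auto|exact (H _ _ _ _ Ha Hb Hc HK)].
      * intros HK. apply (H _ _ _ _ Ha Hb Hc). auto.
Qed.

(** Common to both quantifiers: entry [i] of the function for instance [n] sits at [t n i] in the
    merged function, and [G] constrains [n]. *)
Lemma ar_skolem_body d (K : nat -> nat -> nat -> nat -> env -> Prop) (G : env -> Prop)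
    (t : nat -> nat -> nat) :
  ar (4 + S d) (fun e => K (e 0) (e 1) (e 2) (e 3) (fun i => e (4 + i))) ->
  ar 5 G ->
  (forall j f g, af j f -> af j g -> af j (fun e => t (f e) (g e))) ->
  ar (4 + d) (fun e => exists n k1 a1 b1 c1,
    G (scons n e) /\
    (forall i, i < k1 -> i < e 0 /\ t n i < e 0 /\ at_ a1 i = at_ (e 1) i /\
       at_ b1 i = at_ (e 2) i /\ at_ c1 i = at_ (e 3) (t n i)) /\
    K k1 a1 b1 c1 (scons n (fun i => e (4 + i)))).
Proof.
  intros HK HG Ht. repeat apply ar_ex. apply ar_and; [|apply ar_and].
  - apply (@ar_ren 5 (5 + (4 + d)) G
      (fun e => scons (e 4) (fun i => e (5 + i))) (fun i => 4 + i)); auto; [lia|].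
    intros e [|i]; auto.
  - solve_ar.
  - apply (@ar_ren (4 + S d) (5 + (4 + d)) (fun e => K (e 0) (e 1) (e 2) (e 3) (fun i => e (4 + i)))
      (fun e i => match i with 0 => e 3 | 1 => e 2 | 2 => e 1 | 3 => e 0 |
                  S (S (S (S j))) => scons (e 4) (fun i => e (9 + i)) j end)
      (fun i => match i with 0 => 3 | 1 => 2 | 2 => 1 | 3 => 0 | 4 => 4 | S j => 4 + S j end)); auto.
    + intros [|[|[|[|[|i]]]]]; lia.
    + intros e [|[|[|[|[|i]]]]]; auto.
Qed.

Lemma skolem_all d Q : skolem_form (S d) Q ->
  skolem_form d (fun e g h => forall n, Q (scons n e) g h).
Proof.
  intros (K & HK & E).
  exists (fun k a b c e => exists n k1 a1 b1 c1, True /\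
    (forall i, i < k1 -> i < k /\ pi n i < k /\ at_ a1 i = at_ a i /\
       at_ b1 i = at_ b i /\ at_ c1 i = at_ c (pi n i)) /\
    K k1 a1 b1 c1 (scons n e)).
  split.
  { apply (@ar_skolem_body d K (fun _ => True) pi HK); auto with ardb.
    apply ar_iff with (fun e => 0 = 0); [tauto|auto with ardb]. }
  intros e g h. split.
  - intros H.
    assert (H' : forall n, exists f, forall k a b c,
      agree k a g -> agree k b h -> agree k c f -> ~ K k a b c (scons n e)).
    { intros n. apply E, H. }
    set (F := fun n => proj1_sig (constructive_indefinite_description _ (H' n))).
    exists (fun z => F (p1 z) (p2 z)).
    intros k a b c Ha Hb Hc (n & k1 & a1 & b1 & c1 & _ & H1 & HK1).
    apply (proj2_sig (constructive_indefinite_description _ (H' n)) k1 a1 b1 c1);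
      [| | |exact HK1]; intros i Hi; destruct (H1 i Hi) as (I1 & I2 & Ea & Eb & Ec).
    + rewrite Ea. auto.
    + rewrite Eb. auto.
    + rewrite Ec, Hc by auto. now rewrite p1_pi, p2_pi.
  - intros [f Hf] n. apply E. exists (fun i => f (pi n i)).
    intros k1 a1 b1 c1 Ha Hb Hc HK1.
    (* [M] exceeds every position [pi n i] looked up for [i < k1]. *)
    destruct (bounded_values (fun _ i => pi n i) 1 k1) as [M HM].
    apply (Hf (k1 + M) (pre g (k1 + M)) (pre h (k1 + M)) (pre f (k1 + M))); auto using agree_pre.
    exists n, k1, a1, b1, c1. repeat split; auto; specialize (HM 0 i ltac:(lia) H);
      cbv beta in HM; rewrite ?at_pre by lia; auto; lia.
Qed.

(** Entry 0 of the merged function stores [n]; the others hold the function for that instance. *)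
Lemma skolem_ex d Q : skolem_form (S d) Q ->
  skolem_form d (fun e g h => exists n, Q (scons n e) g h).
Proof.
  intros (K & HK & E).
  exists (fun k a b c e => exists n k1 a1 b1 c1, (0 < k /\ n = at_ c 0) /\
    (forall i, i < k1 -> i < k /\ S i < k /\ at_ a1 i = at_ a i /\
       at_ b1 i = at_ b i /\ at_ c1 i = at_ c (S i)) /\
    K k1 a1 b1 c1 (scons n e)).
  split.
  { apply (@ar_skolem_body d K (fun e => 0 < e 1 /\ e 0 = at_ (e 4) 0) (fun _ i => S i) HK);
      auto with ardb. }
  intros e g h. split.
  - intros [n H]. apply E in H as [f Hf].
    exists (fun z => match z with 0 => n | S i => f i end).
    intros k a b c Ha Hb Hc (n' & k1 & a1 & b1 & c1 & [H0 ->] & H1 & HK1).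
    rewrite Hc in HK1 by auto.
    apply (Hf k1 a1 b1 c1); [| | |exact HK1];
      intros i Hi; destruct (H1 i Hi) as (I1 & I2 & Ea & Eb & Ec).
    + rewrite Ea. auto.
    + rewrite Eb. auto.
    + rewrite Ec, Hc by auto. reflexivity.
  - intros [f Hf]. exists (f 0). apply E. exists (fun i => f (S i)).
    intros k1 a1 b1 c1 Ha Hb Hc HK1.
    apply (Hf (S k1) (pre g (S k1)) (pre h (S k1)) (pre f (S k1))); auto using agree_pre.
    exists (f 0), k1, a1, b1, c1. rewrite at_pre by lia. repeat split; auto; try lia;
      rewrite ?at_pre by lia; auto.
Qed.

Lemma skolem_and d Q1 Q2 : skolem_form d Q1 -> skolem_form d Q2 ->
  skolem_form d (fun e g h => Q1 e g h /\ Q2 e g h).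
Proof.
  intros H1 H2. pose proof (skolem_all (skolem_case H1 H2)) as H.
  revert H. apply skolem_iff. intros e g h. split.
  - intros H. split; [apply (H 0)|apply (H 1)].
  - intros [G1 G2] [|n]; auto.
Qed.

Lemma skolem_or d Q1 Q2 : skolem_form d Q1 -> skolem_form d Q2 ->
  skolem_form d (fun e g h => Q1 e g h \/ Q2 e g h).
Proof.
  intros H1 H2. pose proof (skolem_ex (skolem_case H1 H2)) as H.
  revert H. apply skolem_iff. intros e g h. split.
  - intros [[|n] H]; auto.
  - intros [G|G]; [exists 0|exists 1]; auto.
Qed.

(** The normal form gives no direct way to negate, so [A] and its negation are carried along
    together and negations are pushed classically to the atoms. *)
Lemma skolem_sat (A : formula bool) : forall d, bounded d A ->
  let Q e g h := sat (fun b : bool => if b then real_of h else real_of g) e A in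
  skolem_form d Q /\ skolem_form d (fun e g h => ~ Q e g h).
Proof.
  induction A; simpl; intros d HA.
  - destruct HA as [H1 H2]. apply eval_af in H1, H2. split.
    + now apply (@skolem_pure d (fun e => eval e s = eval e t)), ar_eq.
    + now apply (@skolem_pure d (fun e => eval e s <> eval e t)), ar_not, ar_eq.
  - destruct HA as [H1 H2]. apply eval_af in H1, H2. split.
    + now apply (@skolem_pure d (fun e => eval e s < eval e t)), ar_lt.
    + now apply (@skolem_pure d (fun e => ~ eval e s < eval e t)), ar_not, ar_lt.
  - assert (E : forall g h i, (if P then real_of h else real_of g) i = true <->
        (if P then h else g) i <> 0).
    { intros g h i. unfold real_of.
      destruct P; rewrite negb_true_iff, Nat.eqb_neq; tauto. }
    split.
    + apply skolem_iff with (2 := @skolem_mem d P (fun P => P) t ltac:(auto) ltac:(auto) HA).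
      intros e g h. symmetry. apply E.
    + apply skolem_iff with (2 := @skolem_mem d P not t (fun P n => @ar_not n P) ltac:(tauto) HA).
      intros e g h. now rewrite <- E.
  - destruct (IHA d HA) as [H1 H2]. split; auto.
    revert H1. apply skolem_iff. intros e g h. split; [tauto|apply NNPP].
  - destruct HA as [HA1 HA2]. destruct (IHA1 d HA1) as [P1 N1], (IHA2 d HA2) as [P2 N2]. split.
    + now apply skolem_and.
    + generalize (skolem_or N1 N2). apply skolem_iff. intros e g h.
      split; [tauto|apply not_and_or].
  - destruct HA as [HA1 HA2]. destruct (IHA1 d HA1) as [P1 N1], (IHA2 d HA2) as [P2 N2]. split.
    + now apply skolem_or.
    + generalize (skolem_and N1 N2). apply skolem_iff. intros e g h. tauto.
  - destruct HA as [HA1 HA2]. destruct (IHA1 d HA1) as [P1 N1], (IHA2 d HA2) as [P2 N2]. split.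
    + generalize (skolem_or N1 P2). apply skolem_iff. intros e g h.
      split; [tauto|apply imply_to_or].
    + generalize (skolem_and P1 N2). apply skolem_iff. intros e g h.
      split; [tauto|apply imply_to_and].
  - destruct (IHA (S d) HA) as [P1 N1]. split.
    + exact (skolem_ex P1).
    + generalize (skolem_all N1). apply skolem_iff. intros e g h.
      split; [intros H [n Hn]; exact (H n Hn)|intros H n Hn; apply H; now exists n].
  - destruct (IHA (S d) HA) as [P1 N1]. split.
    + exact (skolem_all P1).
    + generalize (skolem_ex N1). apply skolem_iff. intros e g h.
      split; [intros [n Hn] H; exact (Hn (H n))|apply not_all_ex_not].
Qed.

Definition forall_exists (K : nat -> nat -> nat -> nat -> Prop) (n : nat) : Prop :=
  forall g, exists f, forall k a c, agree k a g -> agree k c f -> ~ K n k a c.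

Lemma Pi12_normal_form S : Pi12 S -> exists K,
  ar 4 (fun e => K (e 0) (e 1) (e 2) (e 3)) /\ forall n, S n <-> forall_exists K n.
Proof.
  intros (phi & Hphi & HS).
  destruct (skolem_sat Hphi) as [(K & HK & E) _].
  (* [h] merges the function coding [Y], as first components, with the Skolem function, as second
     components. *)
  exists (fun n k a h => exists b c,
    (forall j, j < k -> at_ b j = p1 (at_ h j) /\ at_ c j = p2 (at_ h j)) /\
    K k a b c (scons n (fun _ => 0))).
  split.
  { repeat apply ar_ex. apply ar_and; [solve_ar|].
    apply (@ar_ren 5 6 (fun e => K (e 0) (e 1) (e 2) (e 3) (fun i => e (4 + i)))
      (fun e i => match i with 0 => e 3 | 1 => e 4 | 2 => e 1 | 3 => e 0 |
                  S (S (S (S j))) => scons (e 2) (fun _ => 0) j end)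
      (fun i => match i with 0 => 3 | 1 => 4 | 2 => 1 | 3 => 0 | _ => 2 end)); auto.
    - intros [|[|[|[|i]]]]; lia.
    - intros e [|[|[|[|[|i]]]]] Hi; auto; lia. }
  intros n. rewrite HS.
  (* Set quantifiers become function quantifiers because [real_of] is onto. *)
  transitivity (forall g, exists h,
    sat (fun b : bool => if b then real_of h else real_of g) (scons n (fun _ => 0)) phi).
  { unfold matrix. split.
    - intros H g. destruct (H (real_of g)) as [Y HY].
      exists (fun i => Nat.b2n (Y i)). now rewrite real_of_b2n.
    - intros H X. destruct (H (fun i => Nat.b2n (X i))) as [h Hh].
      exists (real_of h). now rewrite real_of_b2n in Hh. }
  unfold forall_exists. split; intros H g; destruct (H g) as [f Hf].
  - apply E in Hf as [f' Hf]. exists (fun i => pi (f i) (f' i)).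
    intros k a h Ha Hh (b & c & Hbc & HK1). apply (Hf k a b c); auto; intros i Hi;
      destruct (Hbc i Hi) as [H1 H2]; rewrite Hh in H1, H2 by auto;
      now rewrite ?p1_pi, ?p2_pi in *.
  - exists (fun i => p1 (f i)). apply E. exists (fun i => p2 (f i)).
    intros k a b c Ha Hb Hc HK1. apply (Hf k a (pre f k)); auto using agree_pre.
    exists b, c. split; auto. intros j Hj. rewrite at_pre by auto. auto.
Qed.

(** * Diagonalization *)

(** Taking the least output makes uniqueness immediate, without proving that [Ev] is
    single-valued. *)
Definition Diag (m s : nat) : Prop :=
  Ev (tr m (pi m 0) s) /\ forall s', s' < s -> ~ Ev (tr m (pi m 0) s').

Lemma Diag_inj m s s' : Diag m s -> Diag m s' -> s = s'.
Proof.
  intros [H1 H2] [H3 H4]. destruct (lt_eq_lt_dec s s') as [[H|H]|H]; auto.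
  - now apply H4 in H1.
  - now apply H2 in H3.
Qed.

Lemma Diag_recursive (r : nat -> nat) : rec_fn 1 (fun e => r (e 0)) -> exists m, Diag m (r m).
Proof.
  intros Hr. apply recursive1_iff, recursive_computes in Hr as [m Hm].
  assert (H : forall y, Ev (tr m (pi m 0) y) <-> y = r m).
  { intros y. apply (Hm (Vector.cons _ m _ (Vector.nil _))). }
  exists m. split; [now apply H|]. intros s' Hs Hs'. apply H in Hs'. lia.
Qed.

Lemma bound_exists m : exists N,
  (N = 0 /\ forall s, ~ Diag m s) \/ exists s, N = S s /\ Diag m s.
Proof.
  destruct (classic (exists s, Diag m s)) as [[s Hs]|H]; [exists (S s); eauto|].
  exists 0. left. split; auto. intros s Hs. eauto.
Qed.

(** The part of a witness that the diagonalization against program [m] may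
    have inspected lies below [bound m]. *)
Definition bound (m : nat) : nat :=
  proj1_sig (constructive_indefinite_description _ (bound_exists m)).

Lemma bound_spec m :
  (bound m = 0 /\ forall s, ~ Diag m s) \/ exists s, bound m = S s /\ Diag m s.
Proof. apply (proj2_sig (constructive_indefinite_description _ (bound_exists m))). Qed.

Lemma bound_Diag m s : Diag m s -> bound m = S s.
Proof.
  intros H. destruct (bound_spec m) as [[_ H']|(s' & -> & H')]; [now apply H' in H|].
  f_equal. now apply Diag_inj with m.
Qed.

Lemma ar_Diag n f g : af n f -> af n g -> ar n (fun e => Diag (f e) (g e)).
Proof.
  intros Hf Hg. unfold Diag, tr. apply ar_and.
  - apply ar_Ev. auto with ardb.
  - apply af_shift in Hf as Hf', Hg as Hg'. apply ar_all, ar_imp; [auto with ardb|].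
    apply ar_not, ar_Ev. auto with ardb.
Qed.

Lemma af_bound n f : af n f -> af n (fun e => bound (f e)).
Proof.
  apply (@af_app1 bound).
  apply ar_iff with (fun e => (e 0 = 0 /\ forall s, ~ Diag (e 1) s) \/
    exists s, e 0 = S s /\ Diag (e 1) s).
  - intros e. destruct (bound_spec (e 1)) as [[H1 H2]|(s & H1 & H2)]; rewrite H1; split.
    + intros [[H _]|(s & _ & H)]; auto. now apply H2 in H.
    + intros H. auto.
    + intros [[_ H]|(s' & -> & H)]; [now apply H in H2|]. f_equal. now apply Diag_inj with (e 1).
    + intros H. right. eauto.
  - apply ar_or; [apply ar_and; [solve_ar|]|].
    + apply ar_all, ar_not, ar_Diag; auto with ardb.
    + apply ar_ex, ar_and; [solve_ar|]. apply ar_Diag; auto with ardb.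
Qed.
#[global] Hint Resolve af_bound : ardb.

(** A claim [c] is a tuple [(ty, (i, (w1, w2)))].  With [ty = 0] it claims that
    the atom [(0, i, w1)] is valid, with [ty = 1] that the two different atoms
    [(1, i, w1)] and [(1, i, w2)] are valid.  Atoms [(0, i, w)] say that [w] is
    the value at [i] of the function [y], atoms [(1, i, w)] that it is the value
    at [i] of the function [x]. *)
Definition cty (c : nat) : nat := p1 c.
Definition ci (c : nat) : nat := p1 (p2 c).
Definition cw1 (c : nat) : nat := p1 (p2 (p2 c)).
Definition cw2 (c : nat) : nat := p2 (p2 (p2 c)).

Definition claim (c : nat) : bool :=
  (cty c =? 0) || ((cty c =? 1) && negb (cw1 c =? cw2 c)).

(** A record [s = (l, ((a, b), c))] says that a functional makes claim [c] after
    inspecting [l] bits of the input determined by [a] and [b]. *)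
Definition sl (s : nat) : nat := p1 s.
Definition sa (s : nat) : nat := p1 (p1 (p2 s)).
Definition sb (s : nat) : nat := p2 (p1 (p2 s)).
Definition sc (s : nat) : nat := p2 (p2 s).

(** With [N = S s], the single invalid atom is chosen such that the claim of the
    record [s] is wrong although the values coded by [sa s] are valid. *)
Definition invalid (N ty i w : nat) : bool :=
  (0 <? N) && (cty (sc (pred N)) =? ty) && (ci (sc (pred N)) =? i) &&
  (w =? (if ty =? 0 then cw1 (sc (pred N))
         else if at_ (sa (pred N)) i =? cw1 (sc (pred N)) then cw2 (sc (pred N))
         else cw1 (sc (pred N)))).

Definition correct (N c : nat) : bool :=
  claim c &&
  (if cty c =? 0 then negb (invalid N 0 (ci c) (cw1 c))
   else negb (invalid N 1 (ci c) (cw1 c)) && negb (invalid N 1 (ci c) (cw2 c))).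

Lemma claim_le c : ci c <= c /\ cw1 c <= c /\ cw2 c <= c.
Proof.
  unfold ci, cw1, cw2.
  pose proof (p2_le c). pose proof (p1_le (p2 c)). pose proof (p2_le (p2 c)).
  pose proof (p1_le (p2 (p2 c))). pose proof (p2_le (p2 (p2 c))). lia.
Qed.

Lemma sc_le s : sc s <= s.
Proof. unfold sc. pose proof (p2_le s). pose proof (p2_le (p2 s)). lia. Qed.

(** Components are bounded by their codes. So positions and values from [N] on are always valid. *)
Lemma invalid_lt N ty i w : invalid N ty i w = true -> i < N /\ w < N.
Proof.
  unfold invalid. rewrite !andb_true_iff, Nat.ltb_lt, !Nat.eqb_eq.
  intros [[[H1 H2] <-] H3].
  pose proof (sc_le (pred N)). pose proof (claim_le (sc (pred N))).
  destruct (ty =? 0); [lia|]. destruct (at_ _ _ =? _); lia.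
Qed.

Lemma invalid_unique N ty i w ty' i' w' :
  invalid N ty i w = true -> invalid N ty' i' w' = true -> ty = ty' /\ i = i' /\ w = w'.
Proof.
  unfold invalid. rewrite !andb_true_iff, !Nat.eqb_eq.
  intros [[[_ <-] <-] ->] [[[_ <-] <-] ->]. auto.
Qed.

(** Of the two different values in a claim about [x], the one declared invalid differs from the
    recorded value. *)
Lemma invalid_record s i :
  claim (sc s) = true -> invalid (S s) 1 i (at_ (sa s) i) = false.
Proof.
  intros Hc. apply not_true_iff_false. unfold invalid. cbn [pred].
  rewrite !andb_true_iff, !Nat.eqb_eq. intros [[[_ Hty] <-] H].
  unfold claim in Hc. rewrite Hty in Hc. simpl in Hc.
  rewrite negb_true_iff, Nat.eqb_neq in Hc. change (1 =? 0) with false in H. cbv iota in H.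
  destruct (Nat.eqb_spec (at_ (sa s) (ci (sc s))) (cw1 (sc s))); congruence.
Qed.

Lemma correct_record s : correct (S s) (sc s) = false.
Proof.
  apply not_true_iff_false. unfold correct.
  rewrite andb_true_iff. intros [Hc H]. unfold claim in Hc.
  destruct (Nat.eqb_spec (cty (sc s)) 0) as [H0|H0].
  - rewrite negb_true_iff in H. unfold invalid in H. cbn [pred] in H.
    rewrite H0, !Nat.eqb_refl in H. discriminate.
  - simpl in Hc. rewrite andb_true_iff, Nat.eqb_eq in Hc. destruct Hc as [H1 _].
    rewrite andb_true_iff, !negb_true_iff in H. unfold invalid in H. cbn [pred] in H.
    rewrite H1, !Nat.eqb_refl in H. change (1 =? 0) with false in H.
    change (0 <? S s) with true in H. cbv iota in H. cbn [andb] in H.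
    destruct (at_ _ _ =? _); rewrite Nat.eqb_refl in H; easy.
Qed.

(** [x] and [y] both code a function from position [bound m] on; earlier
    positions are irrelevant, except that [i, y i < bound m] marks [y] as void.
    The pair [r] of sequences of values of [x] and [y] is good when these are
    valid and either exhibit [y] as void or form an instance of [K]. *)
Definition good (K : nat -> nat -> nat -> nat -> Prop) (n N r : nat) : Prop :=
  (forall i, i < len (p2 r) ->
     invalid N 1 i (at_ (p1 r) i) = false /\ invalid N 0 i (at_ (p2 r) i) = false) /\
  ((exists i, i < len (p2 r) /\ i < N /\ at_ (p2 r) i < N) \/
   exists k a c, N + k <= len (p2 r) /\
     (forall j, j < k -> at_ a j = at_ (p1 r) (N + j) /\ at_ c j = at_ (p2 r) (N + j)) /\
     K n k a c).

Definition valid_rows (ty N : nat) (X : real) : Prop :=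
  forall i, exists w, starts_with (row X i) w /\ invalid N ty i w = false.

(** [refuter], [claimant] and [escaper] are the witness relations of the formulas used in the
    reductions, with contentless parts replaced by their truth conditions. *)
Definition refuter (K : nat -> nat -> nat -> nat -> Prop) (n m : nat) (Z : real) : Prop :=
  valid_rows 1 (bound m) (even_part Z) /\
  forall Y, valid_rows 0 (bound m) Y ->
    exists U, maps_to (odd_part Z) Y U /\ exists r, starts_with U r /\ good K n (bound m) r.

Definition claimant (K : nat -> nat -> nat -> nat -> Prop) (n : nat) (V : real) : Prop :=
  forall m Z, refuter K n m Z ->
    exists D, maps_to (row V m) Z D /\
      exists c, starts_with D c /\ correct (bound m) c = true.

Definition escaper (X : real) : Prop :=
  forall m, exists s, starts_with (row X m) s /\ ~ Diag m s.

(** The number in each row is found by searching for the first [false]; the resulting recursive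
    function would be diagonalized at its own index. *)
Lemma no_recursive_escaper X : recursive_real X -> ~ escaper X.
Proof.
  intros HX H. apply recursive1_iff in HX.
  set (r := fun m => proj1_sig (constructive_indefinite_description _ (H m))).
  assert (Hr : forall m, starts_with (row X m) (r m) /\ ~ Diag m (r m)).
  { intros m. apply (proj2_sig (constructive_indefinite_description _ (H m))). }
  destruct (@Diag_recursive r) as [m Hm]; [|now apply (Hr m)].
  apply (@rec_min 1 (fun t e => Nat.b2n (X (pi (e 0) t))) (fun e => r (e 0))).
  - apply (@rec_app1 (fun x => Nat.b2n (X x)) HX 2 (fun e => pi (e 1) (e 0))). auto with recdb.
  - intros e. destruct (Hr (e 0)) as [[H1 H2] _]. unfold row in *. fold (pi (e 0) (r (e 0))) in H2.
    rewrite H2. split; auto. intros t Ht. unfold pi. now rewrite H1.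
Qed.

(** * Canonical refuters *)

(** Empty sequences are excluded because entry 0 is what shows a sequence with a small code to be
    void. *)
Definition matches (u q : nat) : bool :=
  (0 <? len u) && ball (len u) (fun i =>
    ball (at_ u i) (fun j => reads q (pi i j) true) && reads q (pi i (at_ u i)) false).

(** An answer is used only if its values of [x] agree with [w], so an arbitrary table [T] cannot
    misstate [x]. *)
Definition fires (w T : nat -> nat) (q u : nat) : bool :=
  matches u q && (0 <? T u) && ball (len u) (fun i => at_ (pred (T u)) i =? w i).

Definition reply (w T : nat -> nat) (q : nat) : nat :=
  search (slen q) (fires w T q) (fun u => pi (pred (T u)) u).

(** The function [x] is [w], and if [T u > 0], the sequence [u] of values of [y]
    is answered by [u] and the sequence of values of [x] coded by [T u - 1]. *)
Definition canonical (w T : nat -> nat) : real :=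
  mix (graph_rows w) (tab (fun n q => answer n (reply w T q))).

Lemma bmin_ext n p p' : (forall i, i < n -> p i = p' i) -> bmin n p = bmin n p'.
Proof.
  intros H. unfold bmin. induction n as [|n IH]; [reflexivity|].
  simpl. rewrite IH by (intros; apply H; lia). rewrite (H n) by lia. reflexivity.
Qed.

Lemma slen_le q : slen q <= q.
Proof. unfold slen. destruct (bmin_spec q (fun j => Nat.iter j Nat.div2 q <=? 1)) as [_ []]; lia. Qed.

Lemma div2_le x : Nat.div2 x <= x.
Proof. rewrite Nat.div2_div. apply Nat.Div0.div_le_upper_bound. lia. Qed.

(** All decoding decreases numbers, so bit [x] consults [w] and [T] only at arguments up to [x].
    This is what lets finite tables replace [w] and [T] in records. *)
Lemma canonical_local w T w' T' l :
  (forall i, i < l -> w i = w' i) -> (forall u, u < l -> T u = T' u) ->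
  forall x, x < l -> canonical w T x = canonical w' T' x.
Proof.
  intros Hw HT x Hx. unfold canonical, mix.
  pose proof (div2_le x).
  destruct (Nat.odd x).
  - set (z := Nat.div2 x) in *. unfold tab, mix. pose proof (div2_le z).
    pose proof (p2_le (Nat.div2 z)).
    replace (reply w T (p2 (Nat.div2 z))) with (reply w' T' (p2 (Nat.div2 z))); auto.
    set (q := p2 (Nat.div2 z)) in *. pose proof (slen_le q).
    assert (E : bmin (S (slen q)) (fires w T q) = bmin (S (slen q)) (fires w' T' q)).
    { apply bmin_ext. intros u Hu. unfold fires. rewrite HT by lia. f_equal.
      unfold ball. f_equal. apply bmin_ext. intros i Hi.
      pose proof (len_le u). rewrite Hw by lia. reflexivity. }
    unfold reply, search. rewrite E.
    destruct (Nat.leb_spec (bmin (S (slen q)) (fires w' T' q)) (slen q)); auto.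
    rewrite HT by lia. reflexivity.
  - unfold graph_rows, rows. rewrite Hw; auto. pose proof (p1_le (Nat.div2 x)). lia.
Qed.

Lemma matches_sound u Y k y : (forall i, starts_with (row Y i) (y i)) ->
  matches u (segment Y k) = true -> 0 < len u /\ forall i, i < len u -> at_ u i = y i.
Proof.
  intros Hy. unfold matches. rewrite andb_true_iff, Nat.ltb_lt, ball_iff. intros [H0 H].
  split; auto. intros i Hi. specialize (H i Hi).
  rewrite andb_true_iff, ball_iff, reads_segment in H. destruct H as [H1 [_ H2]].
  apply (@starts_with_inj (row Y i)); auto. split; [|exact H2].
  intros j Hj. apply H1, reads_segment in Hj. apply Hj.
Qed.

Lemma matches_complete u Y y : (forall i, starts_with (row Y i) (y i)) ->
  0 < len u -> (forall i, i < len u -> at_ u i = y i) ->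
  exists k0, forall k, k0 <= k -> matches u (segment Y k) = true.
Proof.
  intros Hy H0 H. destruct (bounded_values pi (len u) (S u)) as [M HM].
  exists M. intros k Hk. unfold matches. rewrite andb_true_iff, Nat.ltb_lt, ball_iff.
  split; auto. intros i Hi. pose proof (at_le u i) as Hat. destruct (Hy i) as [H1 H2].
  rewrite <- H in H1, H2 by auto. rewrite andb_true_iff, ball_iff, reads_segment.
  split; [|split; [specialize (HM i (at_ u i)); lia|exact H2]].
  intros j Hj. apply reads_segment. split; [specialize (HM i j); lia|now apply H1].
Qed.

Lemma valid_rows_graph ty N y : (forall i, invalid N ty i (y i) = false) ->
  valid_rows ty N (graph_rows y).
Proof.
  intros H i. exists (y i). split; auto. unfold graph_rows. rewrite row_rows.
  apply starts_with_unary.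
Qed.

Lemma valid_rows_values ty N X : valid_rows ty N X ->
  exists y, forall i, starts_with (row X i) (y i) /\ invalid N ty i (y i) = false.
Proof.
  intros H. exists (fun i => proj1_sig (constructive_indefinite_description _ (H i))).
  intros i. apply (proj2_sig (constructive_indefinite_description _ (H i))).
Qed.

(** If [g] is a counterexample to [forall_exists K n], then every finite part of
    a canonical real with valid values of [x] extends to a refuter: continue [x]
    with [g], and answer [y] when it is seen to be void or caught by [K]. *)
Lemma refuter_extends K n m g w0 T0 :
  (forall f, exists k a c, agree k a g /\ agree k c f /\ K n k a c) ->
  (forall i, i < bound m -> invalid (bound m) 1 i (w0 i) = false) ->
  exists w T, (forall i, i < bound m -> w i = w0 i) /\ (forall u, u < bound m -> T u = T0 u) /\
    refuter K n m (canonical w T).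
Proof.
  intros Hg Hw0. set (N := bound m) in *.
  set (w := fun i => if i <? N then w0 i else g (i - N)).
  set (Good := fun u v => (forall i, i < len u -> at_ v i = w i) /\ good K n N (pi v u)).
  (* Excluded middle decides whether [u] has a good answer; a refuter need not be recursive. *)
  set (T := fun u => if u <? N then T0 u else
    match excluded_middle_informative (exists v, Good u v) with
    | left H => S (proj1_sig (constructive_indefinite_description _ H))
    | right _ => 0
    end).
  assert (Hw : forall i, invalid N 1 i (w i) = false).
  { intros i. unfold w. destruct (Nat.ltb_spec i N); auto.
    apply not_true_iff_false. intros H'. apply invalid_lt in H'. lia. }
  exists w, T. split; [|split].
  { intros i Hi. unfold w. apply Nat.ltb_lt in Hi. now rewrite Hi. }
  { intros u Hu. unfold T. apply Nat.ltb_lt in Hu. now rewrite Hu. }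
  unfold refuter. unfold canonical. rewrite even_part_mix, odd_part_mix. fold N.
  split; [now apply valid_rows_graph|].
  intros Y HY. apply valid_rows_values in HY as [y Hy].
  assert (Hsound : forall k r, reply w T (segment Y k) = S r -> good K n N r).
  { intros k r Hr. apply search_S in Hr as (u & _ & Hf & ->).
    unfold fires in Hf. rewrite !andb_true_iff, Nat.ltb_lt, ball_iff in Hf.
    destruct Hf as [[Hm HT] Hv].
    apply (matches_sound (fun i => proj1 (Hy i))) in Hm as [H0 Hu'].
    destruct (lt_dec u N) as [HuN|HuN].
    - unfold good. rewrite p1_pi, p2_pi. split.
      + intros i Hi. specialize (Hv i Hi). apply Nat.eqb_eq in Hv.
        rewrite Hv, Hu'; auto. split; auto. apply Hy.
      (* The prescribed answers: [at_ u 0 <= u < N] shows [y] to be void at position 0. *)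
      + left. exists 0. pose proof (at_le u 0). repeat split; auto; lia.
    - unfold T in HT |- *. destruct (Nat.ltb_spec u N); [lia|].
      destruct (excluded_middle_informative _) as [H'|H']; [|lia].
      apply (proj2_sig (constructive_indefinite_description _ H')). }
  destruct (Hg (fun i => y (N + i))) as (k & a & c & Ha & Hc & HK).
  (* The extra 1 makes [u] nonempty even if [N] and [k] are 0; [N <= len u <= u] puts [u] outside
     the range governed by [T0]. *)
  set (u := pre y (N + k + 1)).
  assert (Hlen : len u = N + k + 1) by apply len_pre.
  assert (Hu : forall i, i < len u -> at_ u i = y i).
  { intros i Hi. apply at_pre. lia. }
  assert (HG : exists v, Good u v).
  { exists (pre w (N + k + 1)). split; [intros i Hi; apply at_pre; lia|].
    unfold good. rewrite p1_pi, p2_pi. split.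
    - intros i Hi. rewrite Hu, at_pre by lia. split; auto. apply Hy.
    - right. exists k, a, c. split; [lia|]. split; auto.
      intros j Hj. rewrite Hu, at_pre by lia. split; [|now apply Hc].
      rewrite Ha by auto. unfold w. destruct (Nat.ltb_spec (N + j) N); [lia|]. f_equal. lia. }
  destruct (matches_complete (fun i => proj1 (Hy i)) (u := u)) as [k0 Hk0]; [lia|exact Hu|].
  (* [k0] bits exhibit all entries of [u]; adding [u] lets the search, bounded by the segment
     length, reach [u]. *)
  destruct (@maps_to_unary (reply w T) Y (k0 + u)) as (k1 & r & Hr & Hmaps).
  - unfold reply. rewrite slen_segment.
    assert (Hf : fires w T (segment Y (k0 + u)) u = true).
    { unfold fires. rewrite Hk0 by lia. unfold T. pose proof (len_le u).
      destruct (Nat.ltb_spec u N); [lia|].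
      destruct (excluded_middle_informative _) as [H'|H']; [|tauto]. simpl.
      apply ball_iff. intros i Hi. apply Nat.eqb_eq.
      now apply (proj2_sig (constructive_indefinite_description _ H')). }
    apply search_found with u; auto. lia.
  - exists (unary r). split; auto. exists r. split; [apply starts_with_unary|eauto].
Qed.

(** * Escaping the diagonalization *)

Lemma rec_real X : recursive_real X -> forall k g, rec_fn k g -> rec_pred k (fun e => X (g e)).
Proof.
  intros HX. apply recursive1_iff in HX. exact (@rec_app1 (fun x => Nat.b2n (X x)) HX).
Qed.

Lemma maps_to_recursive W X Z :
  recursive_real W -> recursive_real X -> maps_to W X Z -> recursive_real Z.
Proof.
  intros HW HX HZ.
  set (k := fun n => proj1_sig (constructive_indefinite_description _ (HZ n))).
  assert (Hk : forall n,
    (forall j, j < k n -> even_part W (pi n (segment X j)) = false) /\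
    even_part W (pi n (segment X (k n))) = true /\
    odd_part W (pi n (segment X (k n))) = Z n).
  { intros n. apply (proj2_sig (constructive_indefinite_description _ (HZ n))). }
  pose proof (rec_real HW) as RW. pose proof (rec_real HX) as RX.
  assert (Rk : rec_fn 1 (fun e => k (e 0))).
  { apply (@rec_min 1 (fun j e => 1 - Nat.b2n (W (2 * pi (e 0) (segment X j)))) (fun e => k (e 0))).
    - apply rec_sub, rec_b2n, RW; auto with recdb.
      apply rec_mul; auto with recdb. apply rec_pi; auto with recdb.
      apply (@rec_segment 2 (fun i _ => X i)); auto with recdb.
    - intros e. destruct (Hk (e 0)) as (H1 & H2 & _). unfold even_part in *. rewrite H2.
      split; auto. intros j Hj. rewrite H1; auto. }
  apply recursive1_iff. apply rec_ext with
    (fun e => Nat.b2n (W (2 * pi (e 0) (segment X (k (e 0))) + 1))).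
  - intros e. f_equal. apply (Hk (e 0)).
  - apply RW. apply rec_add; auto with recdb. apply rec_mul; auto with recdb.
    apply rec_pi; auto with recdb. apply (@rec_segment 1 (fun i _ => X i)); auto with recdb.
Qed.

Lemma rec_matches k g h : rec_fn k g -> rec_fn k h -> rec_pred k (fun e => matches (g e) (h e)).
Proof.
  apply (@rec_app2 (fun u q => Nat.b2n (matches u q))). unfold matches.
  apply rec_andb; auto with recdb.
  apply (@rec_ball 2 (fun e => len (e 0)) (fun i e =>
    ball (at_ (e 0) i) (fun j => reads (e 1) (pi i j) true) &&
    reads (e 1) (pi i (at_ (e 0) i)) false)); auto with recdb.
  apply rec_andb.
  - apply (@rec_ball 3 (fun e => at_ (e 1) (e 0)) (fun j e => reads (e 2) (pi (e 0) j) true));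
      auto with recdb. apply rec_reads; auto with recdb. apply (@rec_const _ 1).
  - apply rec_reads; auto with recdb. apply (@rec_const _ 0).
Qed.

Lemma rec_reply k f g h : rec_fn k f -> rec_fn k g -> rec_fn k h ->
  rec_fn k (fun e => reply (at_ (f e)) (at_ (g e)) (h e)).
Proof.
  apply (@rec_app3 (fun a b q => reply (at_ a) (at_ b) q)).
  apply (@rec_search 3 (fun e => slen (e 2)) (fun u e => fires (at_ (e 0)) (at_ (e 1)) (e 2) u)
    (fun u e => pi (pred (at_ (e 1) u)) u)); auto 10 with recdb.
  unfold fires. apply rec_andb; [apply rec_andb; auto 10 using rec_matches with recdb|].
  apply (@rec_ball 4 (fun e => len (e 0))
    (fun i e => at_ (pred (at_ (e 2) (e 0))) i =? at_ (e 1) i)); auto 10 with recdb.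
Qed.

Lemma rec_canonical k f g h : rec_fn k f -> rec_fn k g -> rec_fn k h ->
  rec_pred k (fun e => canonical (at_ (f e)) (at_ (g e)) (h e)).
Proof.
  apply (@rec_app3 (fun a b x => Nat.b2n (canonical (at_ a) (at_ b) x))). unfold canonical.
  apply (@rec_mix 3 (fun i e => graph_rows (at_ (e 0)) i)
    (fun i e => tab (fun n q => answer n (reply (at_ (e 0)) (at_ (e 1)) q)) i)); auto with recdb.
  - apply rec_ltb; auto with recdb.
  - unfold tab.
    assert (H : rec_fn 5 (fun e => answer (p1 (e 0)) (reply (at_ (e 2)) (at_ (e 3)) (p2 (e 0))))).
    { apply rec_answer; auto with recdb. apply rec_reply; auto with recdb. }
    apply (@rec_mix 4
      (fun z e => 0 <? answer (p1 z) (reply (at_ (e 1)) (at_ (e 2)) (p2 z)))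
      (fun z e => 1 <? answer (p1 z) (reply (at_ (e 1)) (at_ (e 2)) (p2 z)))); auto with recdb;
      apply rec_ltb; auto with recdb.
Qed.

Lemma rec_claim k f : rec_fn k f -> rec_pred k (fun e => claim (f e)).
Proof.
  intros Hf. unfold claim.
  apply rec_pred_ext with (fun e => if cty (f e) =? 0 then true else
    (cty (f e) =? 1) && negb (cw1 (f e) =? cw2 (f e))).
  - intros e. destruct (cty (f e) =? 0); reflexivity.
  - unfold cty, cw1, cw2. apply rec_ifb; auto 10 with recdb. apply (@rec_const _ 1).
Qed.

(** Looks for a record confirmed by a finite run of row [m] of the real with segment [q]; whether
    its input is honest is not checked. *)
Definition escape_search (m q : nat) : nat :=
  search (slen q) (fun s => claim (sc s) &&
    simulates q (fun i => pi m i) (canonical (at_ (sa s)) (at_ (sb s))) (sc s) (sl s)) (fun s => s).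

Lemma rec_escape_search : rec_fn 2 (fun e => escape_search (e 0) (e 1)).
Proof.
  apply (@rec_search 2 (fun e => slen (e 1)) (fun s e => claim (sc s) &&
      simulates (e 1) (fun i => pi (e 0) i) (canonical (at_ (sa s)) (at_ (sb s))) (sc s) (sl s))
      (fun s _ => s)); auto with recdb.
  apply rec_andb; [unfold sc; auto using rec_claim with recdb|].
  apply (@rec_simulates 3 (fun i e => pi (e 1) i)
    (fun i e => canonical (at_ (sa (e 0))) (at_ (sb (e 0))) i) (fun e => e 2)
    (fun e => sc (e 0)) (fun e => sl (e 0)));
    unfold sc, sl; auto with recdb.
  unfold sa, sb. apply rec_canonical; auto with recdb.
Qed.

(** The records of [F] on canonical inputs escape the diagonalization: if the
    record [s] found for [m] were [Diag m], then its input would extend to a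
    refuter for which the claim of the record is not correct. *)
Lemma escaper_of_claimant K n : ~ forall_exists K n ->
  exists V, recursive_real V /\
    forall F, claimant K n F -> exists D, maps_to V F D /\ escaper D.
Proof.
  intros Hn. unfold forall_exists in Hn. apply not_all_ex_not in Hn as [g Hg].
  assert (Hg' : forall f, exists k a c, agree k a g /\ agree k c f /\ K n k a c).
  { intros f. apply NNPP. intros H. apply Hg. exists f. intros k a c Ha Hc HK.
    apply H. now exists k, a, c. }
  exists (tab (fun i q => answer (p2 i) (escape_search (p1 i) q))). split.
  { apply recursive_tab. apply rec_answer; auto with recdb.
    apply (@rec_app2 escape_search rec_escape_search); auto with recdb. }
  intros F HF. destruct (@maps_to_rows escape_search F) as (r & Hr & Hmaps).
  - intros m.
    (* The value [bound m] is valid at every position, so some refuter exists; the claim of [F] on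
       it yields a record and the search ends. *)
    destruct (@refuter_extends K n m g (fun _ => bound m) (fun _ => 0) Hg') as (w & T & _ & _ & HZ).
    { intros i Hi. apply not_true_iff_false. intros H. apply invalid_lt in H. lia. }
    destruct (HF m _ HZ) as (D & HD & c & Hc & Hcorrect).
    destruct (maps_to_outputs HD Hc) as [l Hl].
    set (s := pi l (pi (pi (pre w l) (pre T l)) c)).
    assert (Hs : sl s = l /\ sa s = pre w l /\ sb s = pre T l /\ sc s = c).
    { unfold sl, sa, sb, sc, s. rewrite ?p2_pi, ?p1_pi, ?p2_pi, ?p1_pi, ?p2_pi. auto. }
    destruct Hs as (E1 & E2 & E3 & E4).
    apply (@outputs_ext _ _ (canonical (at_ (sa s)) (at_ (sb s)))) in Hl.
    2:{ rewrite E2, E3. apply canonical_local; intros i Hi; symmetry; now apply at_pre. }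
    apply (@simulates_complete F (fun i => pi m i)) in Hl as [n0 Hn0].
    exists (n0 + s). apply search_found with s; rewrite ?slen_segment; [lia|].
    rewrite E4, E1, Hn0 by lia. unfold correct in Hcorrect.
    rewrite andb_true_iff in *. tauto.
  - exists (graph_rows r). split; auto. intros m. exists (r m).
    unfold graph_rows. rewrite row_rows. split; [apply starts_with_unary|].
    intros HD. set (s := r m) in *. destruct (Hr m) as [k Hk]. fold s in Hk.
    assert (Hs : claim (sc s) = true /\ outputs (fun i => F (pi m i))
      (canonical (at_ (sa s)) (at_ (sb s))) (sc s) (sl s)).
    { apply search_S in Hk as (s' & _ & Hp & <-). apply andb_true_iff in Hp as [Hp1 Hp2].
      split; auto. now apply simulates_sound in Hp2. }
    destruct Hs as [Hs1 Hs2]. pose proof (bound_Diag HD) as HN.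
    (* As [sl s <= s < bound m], the extension to a refuter changes nothing that the recorded run
       inspected. *)
    destruct (@refuter_extends K n m g (at_ (sa s)) (at_ (sb s)) Hg') as (w & T & Hw & HT & HZ).
    { intros i Hi. rewrite HN. now apply invalid_record. }
    destruct (HF m _ HZ) as (D & HD' & c & Hc & Hcorrect).
    assert (Hout : outputs (fun i => F (pi m i)) (canonical w T) (sc s) (sl s)).
    { revert Hs2. apply outputs_ext. intros i Hi.
      apply canonical_local with (l := bound m).
      - intros j Hj. symmetry. auto.
      - intros j Hj. symmetry. auto.
      - unfold sl in Hi. pose proof (p1_le s). lia. }
    pose proof (outputs_maps_to Hout HD') as Hc'.
    rewrite (starts_with_inj Hc Hc'), HN, correct_record in Hcorrect. discriminate.
Qed.

(** A search state [(b, (r, (l, (i, (ty, w)))))] : on the function [y] coded by [b],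
    the refuter outputs [r] after inspecting [l] bits, and [r] misreports [y i]
    if [ty = 0], and [x i = w] otherwise. *)
Definition misreport (q z : nat) : bool :=
  let b := p1 z in let r := p1 (p2 z) in let l := p1 (p2 (p2 z)) in
  let i := p1 (p2 (p2 (p2 z))) in let ty := p1 (p2 (p2 (p2 (p2 z)))) in
  let w := p2 (p2 (p2 (p2 (p2 z)))) in
  (i <? len (p2 r)) && simulates q (fun i => 2 * i + 1) (graph_rows (at_ b)) r l &&
  (if ty =? 0 then negb (at_ (p2 r) i =? at_ b i) else
     ball w (fun j => reads q (2 * pi i j) true) && reads q (2 * pi i w) false &&
     negb (at_ (p1 r) i =? w)).

Definition reported (z : nat) : nat :=
  let r := p1 (p2 z) in let i := p1 (p2 (p2 (p2 z))) in
  let w := p2 (p2 (p2 (p2 (p2 z)))) in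
  if p1 (p2 (p2 (p2 (p2 z)))) =? 0 then pi 0 (pi i (pi (at_ (p2 r) i) 0))
  else pi 1 (pi i (pi (at_ (p1 r) i) w)).

Definition claim_search (q : nat) : nat := search (slen q) (misreport q) reported.

Lemma rec_claim_search : rec_fn 1 (fun e => claim_search (e 0)).
Proof.
  apply (@rec_search 1 (fun e => slen (e 0)) (fun z e => misreport (e 0) z) (fun z _ => reported z));
    auto with recdb.
  - unfold misreport. cbv zeta. apply rec_andb; [apply rec_andb|].
    + auto 12 with recdb.
    + apply (@rec_simulates 2 (fun i e => 2 * i + 1)
        (fun i e => graph_rows (at_ (p1 (e 0))) i) (fun e => e 1)
        (fun e => p1 (p2 (e 0))) (fun e => p1 (p2 (p2 (e 0))))); auto with recdb.
      apply rec_ltb; auto with recdb.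
    + apply rec_ifb; [auto 12 with recdb..|].
      apply rec_andb; [apply rec_andb|auto 12 with recdb].
      * apply (@rec_ball 2 (fun e => p2 (p2 (p2 (p2 (p2 (e 0))))))
          (fun j e => reads (e 1) (2 * pi (p1 (p2 (p2 (p2 (e 0))))) j) true)); auto 10 with recdb.
        apply rec_reads; auto 12 with recdb. apply (@rec_const _ 1).
      * apply rec_reads; auto 12 with recdb. apply (@rec_const _ 0).
  - unfold reported. cbv zeta. apply rec_if; auto 20 with recdb.
Qed.

Lemma claimant_exists K n : forall_exists K n -> exists V, recursive_real V /\ claimant K n V.
Proof.
  (* One map serves every [m]: the search looks for lies and never has to decide validity. *)
  intros HK. exists (rows (fun _ => tab (fun i q => answer i (claim_search q)))). split.
  { apply recursive1_iff. unfold rows.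
    assert (H : recursive_real (tab (fun i q => answer i (claim_search q)))).
    { apply recursive_tab, rec_answer; auto with recdb.
      apply (@rec_app1 claim_search rec_claim_search). auto with recdb. }
    apply (rec_real H). auto with recdb. }
  intros m Z [Hx HZ]. rewrite row_rows. set (N := bound m) in *.
  apply valid_rows_values in Hx as [w Hw].
  assert (Hex : exists z k, z <= k /\ misreport (segment Z k) z = true).
  { destruct (HK (fun i => w (N + i))) as [f Hf].
    (* The value [N] at early positions is valid and keeps [y] from being void. *)
    set (y := fun i => if i <? N then N else f (i - N)).
    destruct (HZ (graph_rows y)) as (U & HU & r & Hr & Hatoms & Hgood).
    { apply valid_rows_graph. intros i. apply not_true_iff_false. intros H.
      apply invalid_lt in H. unfold y in H. destruct (Nat.ltb_spec i N); lia. }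
    fold N in Hatoms, Hgood.
    destruct (maps_to_outputs HU Hr) as [l Hl].
    (* A truthful report would be void or an instance of [K]; the choice of [y] and [f] rules out
       both. *)
    assert (Hlie : exists i, i < len (p2 r) /\ (at_ (p2 r) i <> y i \/ at_ (p1 r) i <> w i)).
    { apply NNPP. intros H.
      assert (H' : forall i, i < len (p2 r) -> at_ (p2 r) i = y i /\ at_ (p1 r) i = w i).
      { intros i Hi. split; apply NNPP; intros H'; apply H; eauto. }
      destruct Hgood as [(i & H1 & H2 & H3)|(k & a & c & H1 & H2 & H3)].
      - destruct (H' i H1) as [E _]. unfold y in E. apply Nat.ltb_lt in H2.
        rewrite H2 in E. lia.
      - apply (Hf k a c); auto; intros j Hj; destruct (H2 j Hj) as [E1 E2];
          destruct (H' (N + j) ltac:(lia)) as [E3 E4]; [congruence|].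
        rewrite E2, E3. unfold y. destruct (Nat.ltb_spec (N + j) N); [lia|]. f_equal. lia. }
    destruct Hlie as (i & Hi & Hlie).
    set (b := pre y (l + len (p2 r))).
    assert (Hb : forall j, j < l + len (p2 r) -> at_ b j = y j) by (intros; now apply at_pre).
    apply (@outputs_ext _ _ (graph_rows (at_ b))) in Hl.
    2:{ intros j Hj. unfold graph_rows, rows. rewrite Hb; auto. pose proof (p1_le j). lia. }
    apply (@simulates_complete Z (fun i => 2 * i + 1)) in Hl as [n0 Hn0].
    set (z := pi b (pi r (pi l (pi i
      (pi (if excluded_middle_informative (at_ (p2 r) i <> y i) then 0 else 1) (w i)))))).
    destruct (bounded_values (fun _ j => 2 * pi i j) 1 (S (w i))) as [M HM].
    exists z, (n0 + M + z). split; [lia|]. unfold misreport, z. cbv zeta.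
    rewrite ?p2_pi, ?p1_pi, ?p2_pi, ?p1_pi, ?p2_pi, ?p1_pi, ?p2_pi, ?p1_pi. fold z.
    rewrite Hn0 by lia. apply Nat.ltb_lt in Hi as Hi'. rewrite Hi'. cbn [andb].
    destruct (excluded_middle_informative _) as [H|H].
    - cbn [Nat.eqb]. apply negb_true_iff, Nat.eqb_neq. rewrite Hb; auto. lia.
    - destruct Hlie as [|Hlie]; [tauto|]. cbn [Nat.eqb].
      destruct (Hw i) as [[Hw1 Hw2] _].
      rewrite !andb_true_iff, ball_iff, reads_segment, negb_true_iff, Nat.eqb_neq.
      repeat split; auto.
      + intros j Hj. apply reads_segment. split; [specialize (HM 0 j); lia|now apply Hw1].
      + specialize (HM 0 (w i)); lia. }
  destruct Hex as (z0 & k & Hz0 & Hmis).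
  destruct (@maps_to_unary claim_search Z k) as (k1 & c & Hc & Hmaps).
  { apply search_found with z0; rewrite ?slen_segment; auto. }
  exists (unary c). split; auto. exists c. split; [apply starts_with_unary|].
  (* The misreport actually found may differ from [z0], and its [b] may contain the invalid atom. *)
  apply search_S in Hc as (z & _ & Hm & ->).
  clear z0 k Hz0 Hmis Hmaps HK.
  unfold misreport in Hm. unfold reported. cbv zeta in *.
  set (b := p1 z) in *. set (r := p1 (p2 z)) in *. set (l := p1 (p2 (p2 z))) in *.
  set (i := p1 (p2 (p2 (p2 z)))) in *. set (ty := p1 (p2 (p2 (p2 (p2 z))))) in *.
  set (v := p2 (p2 (p2 (p2 (p2 z))))) in *.
  rewrite !andb_true_iff, Nat.ltb_lt in Hm. destruct Hm as [[Hi Hsim] Hm].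
  apply simulates_sound in Hsim.
  (* Only on a valid [b] is the refuter obliged to report valid atoms. *)
  assert (Hvalid : (forall j, invalid N 0 j (at_ b j) = false) ->
    invalid N 1 i (at_ (p1 r) i) = false /\ invalid N 0 i (at_ (p2 r) i) = false).
  { intros H. destruct (HZ _ (valid_rows_graph H)) as (U & HU & r' & Hr' & Hatoms & _).
    pose proof (@outputs_maps_to (odd_part Z) _ _ _ _ Hsim HU) as Hr.
    rewrite (starts_with_inj Hr' Hr) in Hatoms. now apply Hatoms. }
  unfold correct, claim, cty, ci, cw1, cw2.
  destruct (Nat.eqb_spec ty 0) as [Hty|Hty].
  - rewrite !p2_pi, !p1_pi. cbn [Nat.eqb orb andb]. apply negb_true_iff.
    apply negb_true_iff, Nat.eqb_neq in Hm.
    apply not_true_iff_false. intros Hinv.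
    (* The one invalid atom would be the reported atom of [y] at [i], which [b] contradicts, so [b]
       is valid. *)
    enough (H : forall j, invalid N 0 j (at_ b j) = false) by (destruct (Hvalid H); congruence).
    intros j. apply not_true_iff_false. intros H.
    destruct (invalid_unique Hinv H) as (_ & <- & E). auto.
  - rewrite !p2_pi, !p1_pi. cbn [Nat.eqb orb andb].
    rewrite !andb_true_iff, ball_iff, reads_segment in Hm. destruct Hm as [[H1 [_ H2]] H3].
    assert (Hv : w i = v).
    { apply (@starts_with_inj (row (even_part Z) i)); [apply Hw|].
      split; [|exact H2]. intros j Hj. apply H1, reads_segment in Hj. apply Hj. }
    rewrite H3. cbn [andb]. rewrite <- Hv, (proj2 (Hw i)), andb_true_r. apply negb_true_iff.
    apply not_true_iff_false. intros Hinv.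
    (* An invalid atom of [x] leaves no invalid atom of [y]. *)
    enough (H : forall j, invalid N 0 j (at_ b j) = false) by (destruct (Hvalid H); congruence).
    intros j. apply not_true_iff_false. intros H.
    destruct (invalid_unique Hinv H) as (E & _). discriminate.
Qed.

(** * The reductions *)

(** If [forall_exists K n] failed, the escaper computed from a recursive claimant would be
    recursive. *)
Lemma claimant_iff K n : forall_exists K n <-> exists V, recursive_real V /\ claimant K n V.
Proof.
  split; [apply claimant_exists|]. intros (F & HF & HC). apply NNPP. intros H.
  apply escaper_of_claimant in H as (V & HV & H). destruct (H F HC) as (D & HD & HE).
  now apply (no_recursive_escaper (maps_to_recursive HV HF HD)).
Qed.

Lemma escaper_iff K n : ~ forall_exists K n <-> exists V, recursive_real V /\
  forall F, claimant K n F -> exists D, maps_to V F D /\ escaper D.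
Proof.
  split; [apply escaper_of_claimant|]. intros (V & HV & H) HK.
  apply claimant_exists in HK as (F & HF & HC). destruct (H F HC) as (D & HD & HE).
  now apply (no_recursive_escaper (maps_to_recursive HV HF HD)).
Qed.

Lemma af_invalid n f g h l : af n f -> af n g -> af n h -> af n l ->
  af n (fun e => Nat.b2n (invalid (f e) (g e) (h e) (l e))).
Proof.
  apply (@rec_af4 (fun N ty i w => Nat.b2n (invalid N ty i w))).
  unfold invalid, cty, ci, cw1, cw2, sa, sc.
  apply rec_andb; [auto 15 with recdb|]. apply rec_eqb; [auto with recdb|].
  apply rec_if; [auto 15 with recdb..|]. apply rec_if; auto 15 with recdb.
Qed.

Lemma af_correct n f g : af n f -> af n g -> af n (fun e => Nat.b2n (correct (f e) (g e))).
Proof.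
  apply (@rec_af2 (fun N c => Nat.b2n (correct N c))).
  assert (Hinv : forall k f g h l, rec_fn k f -> rec_fn k g -> rec_fn k h -> rec_fn k l ->
    rec_pred k (fun e => invalid (f e) (g e) (h e) (l e))).
  { intros. unfold invalid, cty, ci, cw1, cw2, sa, sc.
    apply rec_andb; [auto 15 with recdb|]. apply rec_eqb; [auto with recdb|].
    apply rec_if; [auto 15 with recdb..|]. apply rec_if; auto 15 with recdb. }
  unfold correct. apply rec_andb; [auto using rec_claim with recdb|].
  unfold cty, ci, cw1, cw2. apply rec_ifb; auto 15 with recdb.
Qed.

Lemma ar_bool n f (b : bool) : af n (fun e => Nat.b2n (f e)) -> ar n (fun e => f e = b).
Proof.
  intros H. apply ar_iff with (fun e => Nat.b2n (f e) = Nat.b2n b).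
  - intros e. destruct (f e), b; simpl; split; congruence.
  - auto with ardb.
Qed.

Lemma ar_good K : ar 4 (fun e => K (e 0) (e 1) (e 2) (e 3)) ->
  ar 3 (fun e => good K (e 0) (bound (e 2)) (e 1)).
Proof.
  intros HK. unfold good. apply ar_and.
  - apply ar_all, ar_imp; [solve_ar|].
    apply ar_and; apply ar_bool, af_invalid; auto with ardb.
  - apply ar_or; [solve_ar|]. repeat apply ar_ex. apply ar_and; [solve_ar|].
    apply ar_and; [solve_ar|].
    apply (@ar_ren 4 6 (fun e => K (e 0) (e 1) (e 2) (e 3))
      (fun e i => match i with 0 => e 3 | 1 => e 2 | 2 => e 1 | _ => e 0 end)
      (fun i => match i with 0 => 3 | 1 => 2 | 2 => 1 | _ => 0 end)); auto.
    + intros [|[|[|i]]]; lia.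
    + intros e [|[|[|[|i]]]]; auto; lia.
Qed.

Lemma witness_ex A (P : env -> Prop) : (forall e X, witness e A X <-> P e) ->
  forall e X, witness e (Ex A) X <-> exists n, starts_with X n /\ P (scons n e).
Proof.
  intros H e X. simpl. split; intros (n & H1 & H2); exists n; split; auto; now apply H in H2 || apply H.
Qed.

(* The parameter [n] enters as a numeral inside a negation, hence contentless. *)
Definition at_numeral (A : arith_formula) (n : nat) : arith_formula :=
  Not (Ex (And (Eq (Var 0) (num n)) A)).

Lemma witness_at_numeral A n e X : witness e (at_numeral A n) X <-> ~ satA (scons n e) A.
Proof.
  change (~ (exists Y, witness e (Ex (And (Eq (Var 0) (num n)) A)) Y) <-> ~ satA (scons n e) A).
  rewrite witness_iff_true. unfold satA. simpl. split.
  - intros H HA. apply H. exists n. now rewrite eval_num.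
  - intros H (x & E & HA). rewrite eval_num in E. now subst.
Qed.

Definition claimant_formula (X Y G C : arith_formula) (n : nat) : arith_formula :=
  All (Imp (And (All (Ex X)) (Imp (All (Ex Y)) (Ex (at_numeral G n)))) (Ex C)).

(** Only the numeral for [n] varies; all other subformulas contribute constants. *)
Lemma recursive_godel_claimant X Y G C :
  rec_fn 1 (fun e => godel (claimant_formula X Y G C (e 0))).
Proof.
  assert (Hnum : rec_fn 1 (fun e => term_code (num (e 0)))).
  { apply rec_ext with (fun e => nat_rect (fun _ => nat) (term_code Zero)
      (fun _ r => pi 3 (pi r (term_code One))) (e 0)).
    - intros e. induction (e 0) as [|n IH]; [reflexivity|].
      exact (f_equal (fun r => pi 3 (pi r (term_code One))) IH).
    - apply (@rec_nat_rect 1 (fun _ => term_code Zero)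
        (fun _ r _ => pi 3 (pi r (term_code One))) (fun e => e 0)); auto with recdb. }
  apply rec_ext with (fun e => pi 7 (pi 5 (pi (pi 3 (pi (godel (All (Ex X)))
    (pi 5 (pi (godel (All (Ex Y)))
      (pi 6 (pi 2 (pi 6 (pi 3 (pi (pi 0 (pi (term_code (Var 0)) (term_code (num (e 0)))))
        (godel G))))))))))
    (godel (Ex C))))); [reflexivity|].
  auto 30 with recdb.
Qed.

Lemma many_one_reducible_formula S (A : nat -> arith_formula) :
  (forall n, sentence (A n)) -> rec_fn 1 (fun e => godel (A (e 0))) ->
  (forall n, S n <-> constructively_true (A n)) -> many_one_reducible S constructive_truth.
Proof.
  intros HA Hrec HS. exists (fun n => godel (A n)). split; [now apply recursive1_iff|].
  intros n. rewrite HS. split; [now exists (A n)|].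
  (* Injectivity of [godel] identifies the sentence that the code came from. *)
  intros (B & _ & HB & E). apply godel_inj in E as ->. exact HB.
Qed.

Lemma claimant_formulas K : ar 4 (fun e => K (e 0) (e 1) (e 2) (e 3)) ->
  exists F : nat -> arith_formula,
    (forall n, sentence (F n)) /\ rec_fn 1 (fun e => godel (F (e 0))) /\
    forall n e V, witness e (F n) V <-> claimant K n V.
Proof.
  intros HK.
  assert (Hinv : forall ty, exists A : arith_formula, bounded 3 A /\
    forall e X, witness e A X <-> invalid (bound (e 2)) ty (e 1) (e 0) = false).
  { intros ty. apply (@ar_contentless 3 (fun e => invalid (bound (e 2)) ty (e 1) (e 0) = false)).
    apply ar_bool, af_invalid; auto with ardb. }
  destruct (Hinv 1) as (AX & BX & EX), (Hinv 0) as (AY & BY & EY).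
  (* [at_numeral] negates its argument, so it receives the negation of [good]. *)
  destruct (ar_not (ar_good HK)) as (AG & BG & EG).
  destruct (@ar_contentless 2 (fun e => correct (bound (e 1)) (e 0) = true)) as (AC & BC & EC).
  { apply ar_bool, af_correct; auto with ardb. }
  exists (claimant_formula AX AY AG AC). split; [|split].
  - intros n. repeat split; auto; (apply num_bounded || (simpl; lia)).
  - apply recursive_godel_claimant.
  - assert (Hrows : forall ty A, (forall e X, witness e A X <->
        invalid (bound (e 2)) ty (e 1) (e 0) = false) ->
      forall m e X, witness (scons m e) (All (Ex A)) X <-> valid_rows ty (bound m) X).
    { intros ty A HA m e X. split; intros H i.
      - now apply (witness_ex HA (scons i (scons m e)) (row X i)).
      - apply (witness_ex HA (scons i (scons m e)) (row X i)), H. }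
    intros n e V.
    assert (Hgood : forall m U, witness (scons m e) (Ex (at_numeral AG n)) U <->
      exists r, starts_with U r /\ good K n (bound m) r).
    { intros m U. rewrite (@witness_ex _ (fun e => ~ satA (scons n e) AG));
        [|apply witness_at_numeral].
      split; intros (r & H1 & H2); exists r; split; auto.
      - rewrite EG in H2. now apply NNPP.
      - rewrite EG. auto. }
    assert (Hrefuter : forall m Z,
      witness (scons m e) (And (All (Ex AX)) (Imp (All (Ex AY)) (Ex (at_numeral AG n)))) Z <->
      refuter K n m Z).
    { intros m Z. unfold refuter. rewrite <- (Hrows 1 AX EX m e).
      split; intros [H1 H2]; (split; [exact H1|]); intros Y HY.
      - apply (Hrows 0 AY EY m e) in HY. destruct (H2 Y HY) as (U & HU & HG).
        exists U. split; auto. now apply Hgood.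
      - apply (Hrows 0 AY EY m e) in HY. destruct (H2 Y HY) as (U & HU & HG).
        exists U. split; auto. now apply Hgood. }
    split; intros H m Z HZ; apply Hrefuter in HZ; destruct (H m Z HZ) as (D & HD & HC);
      exists D; split; auto; now apply (witness_ex EC (scons m e) D).
Qed.

Lemma hardness K : ar 4 (fun e => K (e 0) (e 1) (e 2) (e 3)) ->
  many_one_reducible (forall_exists K) constructive_truth /\
  many_one_reducible (fun n => ~ forall_exists K n) constructive_truth.
Proof.
  intros HK. destruct (claimant_formulas HK) as (F & HF & Hrec & EF).
  destruct (@ar_contentless 2 (fun e => ~ Diag (e 1) (e 0))) as (AD & BD & ED).
  { apply ar_not, ar_Diag; auto with ardb. }
  set (E := All (Ex AD)).
  assert (EE : forall e D, witness e E D <-> escaper D).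
  { intros e D. split; intros H m; now apply (witness_ex ED (scons m e) (row D m)). }
  split.
  - apply many_one_reducible_formula with F; auto. intros n. rewrite claimant_iff.
    split; intros (V & HV & H); exists V; split; auto; now apply EF in H || apply EF.
  - apply many_one_reducible_formula with (fun n => Imp (F n) E).
    + intros n. now split; [apply HF|].
    + apply rec_ext with (fun e => pi 5 (pi (godel (F (e 0))) (godel E))); [reflexivity|].
      auto with recdb.
    + intros n. rewrite escaper_iff.
      split; intros (V & HV & H); exists V; (split; [exact HV|]); intros Y HY.
      * apply EF in HY. destruct (H Y HY) as (D & HD & HE). exists D. split; auto. now apply EE.
      * apply (EF n (fun _ => 0)) in HY. destruct (H Y HY) as (D & HD & HE).
        exists D. split; auto. now apply EE in HE.
Qed.

Theorem theorem7 :
  (forall S : nat -> Prop, Pi12 S -> many_one_reducible S constructive_truth) /\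
  (forall S : nat -> Prop, Sigma12 S -> many_one_reducible S constructive_truth).
Proof.
  split; intros S HS.
  - apply Pi12_normal_form in HS as (K & HK & E).
    destruct (hardness HK) as [(f & Hf & H) _]. exists f. split; auto.
    intros n. now rewrite E.
  - destruct HS as (phi & Hphi & HS).
    destruct (@Pi12_normal_form (fun n => ~ S n)) as (K & HK & E).
    (* The complement of a [Sigma12] set is [Pi12], and the reduction of the complement of that one
       is used. *)
    { exists (Not phi). split; auto. intros n. rewrite HS. split.
      - intros H X. apply NNPP. intros H'. apply H. exists X. intros Y.
        apply NNPP. intros HY. apply H'. now exists Y.
      - intros H [X HX]. destruct (H X) as [Y HY]. exact (HY (HX Y)). }
    destruct (hardness HK) as [_ (f & Hf & H)]. exists f. split; auto.
    intros n. rewrite <- H, <- E. split; [tauto|apply NNPP].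
Qed.
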